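(* Let $H$ be a Hilbert space, $\varrho_0\in\mathbb{R}_{>0}$, $s\in(0,1)$, and let $F:\mathring{C}_\infty(\mathbb{R};H)\to\mathring{C}_\infty^+(\mathbb{R};H)'$ be such that for every $\varrho>\varrho_0$ there is $K>0$ with $$|F(0)(\psi)|\le K|\psi|_{-\varrho,1}\quad\text{and}\quad|F(u)(\psi)-F(w)(\psi)|\le s|\psi|_{-\varrho,1}|u-w|_{\varrho,0}$$ for all $u,w\in\mathring{C}_\infty(\mathbb{R};H)$, $\psi\in\mathring{C}_\infty^+(\mathbb{R};H)$. For $\varrho>\varrho_0$ let $F_\varrho:H_{\varrho,0}(\mathbb{R})\otimes H\to H_{\varrho,-1}(\mathbb{R})\otimes H$ be the unique Lipschitz continuous extension of $F$. Then for every $\varrho>\varrho_0$ the mapping $\partial_{0,\varrho}^{-1}F_\varrho:H_{\varrho,0}(\mathbb{R})\otimes H\to H_{\varrho,0}(\mathbb{R})\otimes H$ is causal.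
   Context: $H$ is a Hilbert space over $\mathbb{K}\in\{\mathbb{R},\mathbb{C}\}$. For $\varrho\in\mathbb{R}$, $H_{\varrho,0}(\mathbb{R})\otimes H$ is the Hilbert space of (classes of) measurable $f:\mathbb{R}\to H$ with $|f|_{\varrho,0}^2=\int_{\mathbb{R}}|f(t)|_H^2e^{-2\varrho t}dt<\infty$. For $\varrho\ne0$, $\partial_{0,\varrho}$ is the derivative in $H_{\varrho,0}(\mathbb{R})\otimes H$ with domain $\{f: f'\in H_{\varrho,0}(\mathbb{R})\otimes H\}$ ($f'$ distributional derivative); $H_{\varrho,1}(\mathbb{R})\otimes H$ is its domain with norm $|f|_{\varrho,1}=|\partial_{0,\varrho}f|_{\varrho,0}$. $H_{\varrho,-1}(\mathbb{R})\otimes H$ is the space of continuous linear functionals on $H_{-\varrho,1}(\mathbb{R})\otimes H$, containing $H_{\varrho,0}(\mathbb{R})\otimes H$ via $f\mapsto(\psi\mapsto\int\langle f(t),\psi(t)\rangle_Hdt)$; $\partial_{0,\varrho}$ extends to a unitary operator from $H_{\varrho,0}(\mathbb{R})\otimes H$ onto $H_{\varrho,-1}(\mathbb{R})\otimes H$ by $(\partial_{0,\varrho}f)(\psi)=\int\langle f(t),-(\partial_{0,-\varrho}\psi)(t)\rangle_Hdt$, and $\partial_{0,\varrho}^{-1}$ denotes the inverse of this unitary operator. $\mathring{C}_\infty(\mathbb{R};H)$: smooth compactly supported $H$-valued functions; $\mathring{C}_\infty^+(\mathbb{R};H)$: smooth $\phi:\mathbb{R}\to H$ with $\sup\operatorname{supp}\phi<\infty$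 and some derivative $\phi^{(n)}$ compactly supported; $\mathring{C}_\infty^+(\mathbb{R};H)'$: all linear maps $\mathring{C}_\infty^+(\mathbb{R};H)\to\mathbb{K}$; a functional $w$ with $|w(\psi)|\le c|\psi|_{-\varrho,1}$ is identified with an element of $H_{\varrho,-1}(\mathbb{R})\otimes H$ by continuous extension. A mapping $W:D(W)\subseteq H_{\varrho,0}(\mathbb{R})\otimes X\to H_{\varrho,0}(\mathbb{R})\otimes Y$ ($X,Y$ Hilbert spaces) is causal if for all $a\in\mathbb{R}$ and $x,y\in D(W)$: $\chi_{\mathbb{R}_{<a}}(m_0)(x-y)=0$ implies $\chi_{\mathbb{R}_{<a}}(m_0)(W(x)-W(y))=0$, where $(\chi_{\mathbb{R}_{<a}}(m_0)f)(t)=\chi_{\mathbb{R}_{<a}}(t)f(t)$. *)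

(* Defs.v *)
From HB Require Import structures.
From mathcomp Require Import all_boot all_order all_algebra.
From mathcomp Require Import all_classical all_reals all_analysis.
From mathcomp Require Import complex.
Set Implicit Arguments. Unset Strict Implicit. Unset Printing Implicit Defensive.
Import Order.TTheory GRing.Theory Num.Theory.
Import numFieldNormedType.Exports.
Local Open Scope classical_set_scope.
Local Open Scope ring_scope.

Record Scalars (R : realType) := {
  K : fieldType;
  ofR : R -> K;
  reK : K -> R;
  imK : K -> R;
  iK : K;
  conjK : K -> K;
  absK : K -> R }.
Arguments ofR {R} s _.
Arguments reK {R} s _.
Arguments imK {R} s _.
Arguments iK {R} s.
Arguments conjK {R} s _.
Arguments absK {R} s _.
Arguments K {R} s.

Definition RealS (R : realType) : Scalars R :=
  {| K := (R : fieldType); ofR := id; reK := id; imK := fun _ => 0;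
     iK := 0; conjK := id; absK := fun x => `|x| |}.

Definition CplxS (R : realType) : Scalars R :=
  {| K := (R[i] : fieldType); ofR := fun r => Complex r 0; reK := @complex.Re R;
     imK := @complex.Im R; iK := Complex 0 1; conjK := @complex.conjc R; absK := @Normc.normc R |}.

Section Hilbert.
Context (R : realType) (S : Scalars R) (H : lmodType (K S)) (inner : H -> H -> K S).

Definition normH (x : H) : R := Num.sqrt (reK S (inner x x)).

(* Hilbert space axioms; inner product antilinear in the first and linear
   in the second argument (so that psi |-> int <f t, psi t> dt is linear). *)
Definition is_hilbert : Prop :=
  [/\ (forall x y z (a : K S), inner x (a *: y + z) = a * inner x y + inner x z),
      (forall x y, inner x y = conjK S (inner y x)),
      (forall x, exists r : R, 0 <= r /\ inner x x = ofR S r),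
      (forall x, inner x x = 0 -> x = 0) &
      (forall u : nat -> H,
        (forall e : R, 0 < e -> exists N, forall m n, (N <= m)%N -> (N <= n)%N ->
            normH (u m - u n) < e) ->
        exists l, (fun n => normH (u n - l)) @ \oo --> (0 : R))].

Definition simpleH (g : R -> H) : Prop :=
  exists n (A : 'I_n -> set R) (c : 'I_n -> H),
    (forall i, measurable (A i)) /\
    forall t, g t = \sum_(i < n | `[< A i t >]) c i.

Definition strongly_measurable (f : R -> H) : Prop :=
  exists g : nat -> R -> H, (forall k, simpleH (g k)) /\
    forall t, (fun k => normH (g k t - f t)) @ \oo --> (0 : R).

Definition wint (rho : R) (f : R -> H) : \bar R :=
  (\int[lebesgue_measure]_(t in [set: R])
      ((normH (f t)) ^+ 2 * expR (- (2 * rho * t)))%:E)%E.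

Definition L2w (rho : R) (f : R -> H) : Prop :=
  strongly_measurable f /\ (wint rho f < +oo)%E.

Definition wnorm (rho : R) (f : R -> H) : R := Num.sqrt (fine (wint rho f)).

Definition hasderivH (f : R -> H) (t : R) (v : H) : Prop :=
  (fun h : R => normH (ofR S h^-1 *: (f (t + h) - f t) - v)) @ 0^' --> (0 : R).

Definition is_derivH (f f' : R -> H) : Prop := forall t, hasderivH f t (f' t).

Definition smooth_seq (D : nat -> R -> H) : Prop :=
  forall n t, hasderivH (D n) t (D n.+1 t).

Definition cpt_support (f : R -> H) : Prop :=
  exists a b : R, forall t, t < a \/ b < t -> f t = 0.

Definition Cc (f : R -> H) : Prop :=
  exists D, D 0%N = f /\ smooth_seq D /\ cpt_support f.

Definition Cplus (f : R -> H) : Prop :=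
  exists D, D 0%N = f /\ smooth_seq D /\
    (exists b : R, forall t, b < t -> f t = 0) /\
    exists n, cpt_support (D n).

Definition Kint (g : R -> K S) : K S :=
  ofR S (Rintegral lebesgue_measure [set: R] (fun t => reK S (g t)))
  + iK S * ofR S (Rintegral lebesgue_measure [set: R] (fun t => imK S (g t))).

Definition linear_on_Cplus (phi : (R -> H) -> K S) : Prop :=
  forall (a : K S) psi chi, Cplus psi -> Cplus chi ->
    phi (fun t => a *: psi t + chi t) = a * phi psi + phi chi.

(* phi is (the restriction to \mathring{C}_\infty^+ of) an element of
   H_{rho,-1}(R) (x) H, i.e. linear and bounded w.r.t. |.|_{-rho,1} *)
Definition in_Hm1 (rho : R) (phi : (R -> H) -> K S) : Prop :=
  linear_on_Cplus phi /\
  exists c : R, forall psi psi', Cplus psi -> is_derivH psi psi' ->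
    absK S (phi psi) <= c * wnorm (- rho) psi'.

(* Frho is a Lipschitz continuous extension of F to
   H_{rho,0} -> H_{rho,-1} (elements of H_{rho,-1} represented by their
   restriction to the dense subspace \mathring{C}_\infty^+) *)
Definition lip_extension (rho : R) (F Frho : (R -> H) -> (R -> H) -> K S) : Prop :=
  [/\ (forall u, L2w rho u -> in_Hm1 rho (Frho u)),
      (forall u psi, Cc u -> Cplus psi -> Frho u psi = F u psi) &
      exists L : R, forall u w psi psi', L2w rho u -> L2w rho w ->
        Cplus psi -> is_derivH psi psi' ->
        absK S (Frho u psi - Frho w psi)
          <= L * wnorm (- rho) psi' * wnorm rho (fun t => u t - w t)].

(* v = \partial_{0,rho}^{-1} phi, i.e. v in H_{rho,0} and
   phi(psi) = int <v(t), -psi'(t)> dt  for psi in the test space *)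
Definition is_dinv (rho : R) (phi : (R -> H) -> K S) (v : R -> H) : Prop :=
  L2w rho v /\
  forall psi psi', Cplus psi -> is_derivH psi psi' ->
    phi psi = Kint (fun t => inner (v t) (- psi' t)).

(* chi_{R_{<a}}(m_0) f = 0 (as an element of H_{rho,0}, i.e. a.e.) *)
Definition vanish_before (a : R) (f : R -> H) : Prop :=
  {ae lebesgue_measure, forall t, t < a -> f t = 0}.

Definition causal_dinv (rho : R) (Frho : (R -> H) -> (R -> H) -> K S) : Prop :=
  forall (a : R) (x y v w : R -> H), L2w rho x -> L2w rho y ->
    vanish_before a (fun t => x t - y t) ->
    is_dinv rho (Frho x) v -> is_dinv rho (Frho y) w ->
    vanish_before a (fun t => v t - w t).

End Hilbert.

(* Main.v *)
Require Import Defs.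
From HB Require Import structures.
From mathcomp Require Import all_boot all_order all_algebra.
From mathcomp Require Import all_classical all_reals all_analysis.
From mathcomp Require Import measurable_realfun complex ring lra.
Import Order.TTheory GRing.Theory Num.Theory.
Import numFieldNormedType.Exports HBSimple.
Local Open Scope classical_set_scope.
Local Open Scope ring_scope.

(**
  If [u] and [w] are test functions that agree before [a], and [psi'] is a test
  function supported before some [b < a], then
  [wnorm (- rho) psi' * wnorm rho (u - w) = O (expR (- (rho * (a - b))))].
  Since the Lipschitz constant [s] is the same for every [rho > rho0], letting
  [rho] tend to infinity gives [F u psi = F w psi].  By density this extends to
  [Frho x psi = Frho y psi] for [x], [y] in the weighted L2 space that agree
  before [a], so the difference of the primitives of [Frho x] and [Frho y] is
  orthogonal to all test functions supported before [b], for every [b < a], and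
  therefore vanishes before [a].

  Density rests on the bumps [expR (- 1 / (k (x - al))) * expR (- 1 / (k (be - x)))],
  which converge pointwise to the indicator of ]al, be[; a lambda-system argument
  passes from intervals to measurable sets.  Only the real inner product
  [Re <x, y>] is needed, so both scalar fields are treated at once.
*)

(** * Smooth functions of a real variable *)

Section SmoothCalculus.
Context {R : realType}.
Implicit Types (f g : R -> R) (n : nat).

(** Bridges [is_derive] and the bare difference quotient, the form in which [hasderivH] is
    written. *)
Lemma is_derive1P f (t l : R) :
  is_derive t 1 f l <-> (fun h : R => h^-1 * (f (t + h) - f t)) @ 0^' --> l.
Proof.
have -> : (fun h : R => h^-1 * (f (t + h) - f t)) =
          (fun h : R => h^-1 *: ((f \o shift t) (h *: 1) - f t)).
  by apply/funext => h /=; rewrite /GRing.scale /= mulr1 [h + t]addrC.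
split=> [[df <-]|cf]; first exact: df.
apply: DeriveDef; first by apply/cvg_ex; exists l.
exact: cvg_lim.
Qed.

(** Each level carries its own witness for the derivative, so closure under sums, products and
    affine substitution is an induction on [n] with the usual formulas. *)
Fixpoint ndiff n f : Prop :=
  if n is m.+1 then
    exists f', (forall t : R, is_derive t 1 f (f' t)) /\ ndiff m f'
  else True.

Definition smooth f := forall n, ndiff n f.

Lemma ndiffW n f : ndiff n.+1 f -> ndiff n f.
Proof.
elim: n f => // n IH f [f' [df f'n]].
by exists f'; split=> //; exact: IH.
Qed.

Lemma ndiffD n f g : ndiff n f -> ndiff n g -> ndiff n (fun t => f t + g t).
Proof.
elim: n f g => // n IH f g [f' [df nf']] [g' [dg ng']].
exists (fun t => f' t + g' t); split; last exact: IH.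
by move=> t; apply: is_deriveD.
Qed.

Lemma ndiffM n f g : ndiff n f -> ndiff n g -> ndiff n (fun t => f t * g t).
Proof.
elim: n f g => // n IH f g nf ng.
(* The product rule leaves [f] and [g] themselves as factors, so both are also needed at order
   [n]. *)
have nf0 := ndiffW _ _ nf; have ng0 := ndiffW _ _ ng.
case: nf => [f' [df nf']]; case: ng => [g' [dg ng']].
exists (fun t => f t * g' t + g t * f' t); split.
  by move=> t; apply: is_deriveM.
by apply: ndiffD; apply: IH.
Qed.

Lemma ndiff_cst n (c : R) : ndiff n (fun=> c).
Proof.
by elim: n c => // n IH c; exists (fun=> 0); split=> // t; exact: is_derive_cst.
Qed.

Lemma is_derive_affine f (a b t l : R) : is_derive (a * t + b) 1 f l ->
  is_derive t 1 (fun x => f (a * x + b)) (a * l).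
Proof.
move=> df.
have da : is_derive t 1 ((a \*: (id : R -> R)) + cst b) (a *: 1 + 0).
  by apply: is_deriveD.
rewrite addr0 /GRing.scale /= mulr1 in da.
by rewrite mulrC; exact: (@is_derive1_comp _ f (fun x : R => a * x + b)).
Qed.

Lemma ndiff_affine n f (a b : R) : ndiff n f -> ndiff n (fun t => f (a * t + b)).
Proof.
elim: n f => // n IH f [f' [df nf']].
exists (fun t => a * f' (a * t + b)); split.
  by move=> t; exact: is_derive_affine.
by apply: (ndiffM n (fun=> a)); [exact: ndiff_cst | exact: IH].
Qed.

Lemma smooth_expR : smooth expR.
Proof. by elim=> // n IH; exists expR; split=> // t; exact: is_derive_expR. Qed.

(** The witnesses hidden in [ndiff n f] could vary with [n]; uniqueness of the derivative identifies
    them all with one function. *)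
Lemma smoothP f : smooth f -> exists f', (forall t : R, is_derive t 1 f (f' t)) /\ smooth f'.
Proof.
move=> sf; have [f' [df _]] := sf 1%N; exists f'; split=> // n.
have [g [dg ng]] := sf n.+1.
suff -> : f' = g by [].
apply/funext => t.
by rewrite -(@derive_val _ _ _ _ _ _ _ (df t)) -(@derive_val _ _ _ _ _ _ _ (dg t)).
Qed.

Lemma smooth_derivatives f : smooth f ->
  exists D : nat -> R -> R, D 0%N = f /\ forall n (t : R), is_derive t 1 (D n) (D n.+1 t).
Proof.
move=> sf.
have /choice[next nextP] : forall h : {f : R -> R | smooth f},
    exists k : {f : R -> R | smooth f}, forall t : R, is_derive t 1 (sval h) (sval k t).
  by move=> [h sh]; have [h' [dh sh']] := smoothP h sh; exists (exist _ h' sh').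
by exists (fun n => sval (iter n next (exist _ f sf))).
Qed.

Lemma smooth_continuous f : smooth f -> continuous f.
Proof.
move=> sf t; have [f' [df _]] := smoothP f sf.
by apply: differentiable_continuous; apply/derivable1_diffP; case: (df t).
Qed.

(** The powers [x ^- n] make the family stable under differentiation up to linear combinations, so
    smoothness of all its members is a single induction. *)
Definition flat n (x : R) : R := if 0 < x then x ^- n * expR (- x^-1) else 0.

(** With [y = x^-1], the exponential series gives [y ^+ n.+1 <= (n.+1)! * expR y]. The bound is
    linear in [x], hence strong enough to control difference quotients at 0. *)
Lemma flat_bound n (x : R) : `|flat n x| <= (n.+1)`!%:R * `|x|.
Proof.
rewrite /flat; case: ifPn => [x0|_]; last by rewrite normr0 mulr_ge0.
rewrite ger0_norm ?mulr_ge0 ?invr_ge0 ?exprn_ge0 ?expR_ge0 ?(ltW x0)//.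
rewrite ger0_norm ?(ltW x0)// expRN ler_pdivrMr ?expR_gt0//.
have := @expR_ge1Dxn _ x^-1 n.
rewrite invr_ge0 (ltW x0) => /(_ isT) h.
have f0 : 0 < (n.+1)`!%:R :> R by rewrite ltr0n fact_gt0.
have {}h : x^-1 ^+ n.+1 <= (n.+1)`!%:R * expR x^-1.
  rewrite -ler_pdivrMl// mulrC; apply: le_trans h.
  by rewrite lerDr.
rewrite -mulrA mulrCA -ler_pdivrMl//.
by rewrite -exprVn -exprS.
Qed.

Lemma is_derive_invX n (x : R) : x != 0 ->
  is_derive x 1 (fun y : R => y ^- n) (- (n%:R * x ^- n.+1)).
Proof.
move=> x0; have h := @is_deriveV _ id x 1 1 x0 (is_derive_id _ _).
have := @is_deriveX _ _ _ n x 1 _ h.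
have -> : (fun y : R => (id y)^-1) ^+ n = (fun y : R => y ^- n).
  by apply/funext => y; rewrite exprfctE exprVn.
move/is_derive_eq; apply.
case: n => [|n]; first by rewrite !mul0r /GRing.scale/= mul0r oppr0.
by rewrite /GRing.scale /= mulr1 mulrN -mulrA exprVn -invfM -exprD addn2.
Qed.

Lemma is_derive_flat n (x : R) :
  is_derive x 1 (flat n) (flat n.+2 x - n%:R * flat n.+1 x).
Proof.
have [x0|x0|<-] := ltgtP 0 x.
- have xn0 : x != 0 by rewrite gt_eqF.
  apply: (@near_eq_is_derive _ _ _ (fun y : R => y ^- n * expR (- y^-1))).
    by near=> y; rewrite /flat ifT//; near: y; exact: lt_nbhsr.
  have d1 := is_derive_invX n x xn0.
  have d2 : is_derive x 1 (fun y : R => expR (- y^-1)) (expR (- x^-1) * x ^- 2).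
    apply: (@is_derive1_comp _ expR (fun y : R => - y^-1)).
    have /is_deriveN := @is_deriveV _ id x 1 1 xn0 (is_derive_id _ _).
    move/is_derive_eq; apply.
    by rewrite /GRing.scale /= mulr1 opprK.
  have /is_derive_eq := is_deriveM d1 d2; apply.
  rewrite /flat x0 /GRing.scale /= mulrN; congr (_ - _).
    by rewrite mulrCA mulrC -invfM -exprD addn2.
  by rewrite mulrC mulrA.
- rewrite /flat !(ltNge 0 x) (ltW x0) /= mulr0 subr0.
  apply: (@near_eq_is_derive _ _ _ (cst 0)).
    by near=> y; rewrite ifF//; apply/negbTE; rewrite -leNgt; near: y;
      apply: filterS (lt_nbhsl x0) => y /ltW.
(* At 0 the difference quotient of [flat n] is [flat n.+1 h] for [h > 0] and 0 for [h < 0]; the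
   linear bound makes it tend to 0. *)
- rewrite {2 3}/flat ltxx mulr0 subr0; apply/is_derive1P.
  apply: norm_cvg0.
  apply: (@squeeze_cvgr _ _ _ _ (fun=> 0) (fun h : R => (n.+2)`!%:R * `|h|)).
  + near=> h; rewrite normr_ge0/= add0r {2}/flat ltxx subr0.
    apply: le_trans (flat_bound n.+1 h).
    rewrite /flat; case: ifPn => h0; last by rewrite mulr0 !normr0.
    by rewrite mulrA -invfM -exprS.
  + exact: cvg_cst.
  + rewrite -[X in _ --> X](mulr0 (n.+2)`!%:R); apply: cvgMr.
    rewrite -[X in _ --> X](normr0 R); apply: cvg_norm.
    exact: cvg_within.
Unshelve. all: by end_near. Qed.

Lemma smooth_flat n : smooth (flat n).
Proof.
move=> k; elim: k n => // k IH n.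
exists (fun x => flat n.+2 x - n%:R * flat n.+1 x); split.
  exact: is_derive_flat.
have -> : (fun x => flat n.+2 x - n%:R * flat n.+1 x) =
          (fun x => flat n.+2 x + - n%:R * flat n.+1 x).
  by apply/funext => x; rewrite mulNr.
apply: ndiffD => //; apply: (ndiffM k (fun=> - n%:R)) => //.
exact: ndiff_cst.
Qed.

(** Both arguments are in the form [a * x + b], so that [ndiff_affine] applies directly; the slope
    [k.+1] is positive for every [k] and steepens the flanks. *)
Definition bump (al be : R) (k : nat) (x : R) : R :=
  flat 0 (k.+1%:R * x + - (k.+1%:R * al)) * flat 0 (- k.+1%:R * x + k.+1%:R * be).

Lemma smooth_bump al be k : smooth (bump al be k).
Proof. by move=> n; apply: ndiffM; apply: ndiff_affine; exact: smooth_flat. Qed.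

Lemma flat0_ge0 (x : R) : 0 <= flat 0 x.
Proof. by rewrite /flat; case: ifP => // _; rewrite mulr_ge0 ?expR_ge0// expr0 invr1. Qed.

Lemma flat0_le1 (x : R) : flat 0 x <= 1.
Proof.
rewrite /flat; case: ifPn => // x0; rewrite expr0 invr1 mul1r -expR0 ler_expR.
by rewrite oppr_le0 invr_ge0 ltW.
Qed.

Lemma bump_ge0 al be k x : 0 <= bump al be k x.
Proof. by rewrite mulr_ge0 ?flat0_ge0. Qed.

Lemma bump_le1 al be k x : bump al be k x <= 1.
Proof. by rewrite mulr_ile1 ?flat0_ge0 ?flat0_le1. Qed.

Lemma bump_out al be k x : ~~ (al < x < be) -> bump al be k x = 0.
Proof.
rewrite negb_and -!leNgt /bump => /orP[h|h].
  rewrite {1}/flat ifF ?mul0r//; apply/negbTE.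
  by rewrite -leNgt -mulrBr pmulr_rle0// subr_le0.
rewrite mulrC {1}/flat ifF ?mul0r//; apply/negbTE.
by rewrite -leNgt mulNr addrC -mulrBr pmulr_rle0// subr_le0.
Qed.

Lemma cvg_flat0 (x : R) : 0 < x -> (fun k => flat 0 (k.+1%:R * x)) @ \oo --> (1 : R).
Proof.
move=> x0.
have -> : (fun k => flat 0 (k.+1%:R * x)) = (fun k => expR (- (x^-1 * k.+1%:R^-1))).
  by apply/funext => k; rewrite /flat mulr_gt0// expr0 invr1 mul1r invfM mulrC.
rewrite -[X in _ --> X]expR0; apply: continuous_cvg; first exact: continuous_expR.
rewrite -[X in _ --> X]oppr0; apply: cvgN.
rewrite -[X in _ --> X](mulr0 x^-1); apply: cvgMr.
exact: cvg_harmonic.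
Qed.

Lemma cvg_bump al be x : bump al be ^~ x @ \oo --> (if al < x < be then 1 else 0 : R).
Proof.
case: ifPn => [/andP[h1 h2]|h]; last first.
  have -> : bump al be ^~ x = cst 0 by apply/funext => k; exact: bump_out.
  exact: cvg_cst.
rewrite -[X in _ --> X]mulr1; apply: cvgM.
  under eq_fun do rewrite -mulrBr.
  by apply: cvg_flat0; rewrite subr_gt0.
under eq_fun do rewrite mulNr addrC -mulrBr.
by apply: cvg_flat0; rewrite subr_gt0.
Qed.

(** * Integrals and primitives of compactly supported functions *)

Lemma cpt_integrable (g : R -> R) (al be : R) : continuous g ->
  (forall t, ~~ (al < t < be) -> g t = 0) ->
  lebesgue_measure.-integrable setT (EFin \o g).
Proof.
move=> cg g0.
have -> : EFin \o g = (EFin \o g) \_ `[al, be].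
  apply/funext => t; rewrite patchE; case: ifPn => // /negP tn /=.
  rewrite g0//; apply/negP => /andP[h1 h2]; apply: tn; rewrite inE/= in_itv/=.
  by rewrite !ltW.
have h : lebesgue_measure.-integrable `[al, be] (EFin \o g).
  apply: (@continuous_compact_integrable R g); first exact: segment_compact.
  exact: continuous_subspaceT.
exact: (integrable_mkcond _ _).1 h.
Qed.

(** Subtracting the total integral from the integral up to [t] gives minus the tail integral, which
    is 0 beyond [be]. On the left the primitive is a possibly nonzero constant, which [Cplus]
    permits and [Cc] does not. *)
Lemma smooth_primitive (g : R -> R) (al be : R) : smooth g ->
  (forall t, ~~ (al < t < be) -> g t = 0) ->
  exists G : R -> R, (forall t : R, is_derive t 1 G (g t)) /\ forall t, be <= t -> G t = 0.
Proof.
move=> sg g0; have cg := smooth_continuous _ sg.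
have ig := cpt_integrable g al be cg g0.
pose G0 t := (\int[lebesgue_measure]_(x in `]-oo, t]) g x)%R.
exists (fun t => G0 t - \int[lebesgue_measure]_(x in setT) g x); split=> [t|t bt].
  (* The bound [t + 1] keeps [t] in the interior, as the fundamental theorem requires. *)
  have ig' : lebesgue_measure.-integrable `]-oo, t + 1] (EFin \o g).
    by apply: integrableS ig.
  have tt1 : t < t + 1 by rewrite ltrDl.
  have nyt : (-oo%O < BRight t)%E.
    by rewrite /= ltNyr.
  have [dG Gt] := continuous_FTC1 tt1 ig' nyt (cg t).
  rewrite -[g t]subr0.
  apply: (@is_deriveB _ _ _ G0 (cst (\int[lebesgue_measure]_(x in setT) g x))).
  by apply: DeriveDef => //; rewrite -Gt derive1E.
apply/eqP; rewrite subr_eq0; apply/eqP.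
rewrite /G0 Rintegral_mkcond; apply: eq_Rintegral => x _.
rewrite patchE; case: ifPn => // /negP xt; rewrite g0//.
apply/negP => /andP[_ xb]; apply: xt; rewrite inE/= in_itv/=.
by rewrite ltW// (lt_le_trans xb).
Qed.
End SmoothCalculus.

(** * The underlying real inner product space *)

Section ScalarLaws.
Context {R : realType} {S : Scalars R} (hS : S = RealS R \/ S = CplxS R).
Implicit Types (z w : K S) (r : R).

(** The record [Scalars] carries no laws; those used later are checked here on each of the two
    instances. *)
Lemma reKD z w : reK S (z + w) = reK S z + reK S w.
Proof. by move: z w; case: hS => -> //= -[? ?] [? ?]. Qed.

Lemma reK_ofRM r z : reK S (ofR S r * z) = r * reK S z.
Proof. by move: z; case: hS => -> //= -[? ?] /=; rewrite mul0r subr0. Qed.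

Lemma reK_conj z : reK S (conjK S z) = reK S z.
Proof. by move: z; case: hS => -> //= -[? ?]. Qed.

Lemma reK_ofR r : reK S (ofR S r) = r.
Proof. by case: hS => ->. Qed.

Lemma ofRD r1 r2 : ofR S (r1 + r2) = ofR S r1 + ofR S r2.
Proof. by case: hS => -> //=; apply/eqP; rewrite eq_complex /= addr0 !eqxx. Qed.

Lemma ofRM r1 r2 : ofR S (r1 * r2) = ofR S r1 * ofR S r2.
Proof.
by case: hS => -> //=; apply/eqP; rewrite eq_complex /= !mulr0 mul0r addr0 subr0 !eqxx.
Qed.

Lemma ofR1 : ofR S 1 = 1.
Proof. by case: hS => ->. Qed.

Lemma ofR0 : ofR S 0 = 0.
Proof. by case: hS => ->. Qed.

Lemma ofRN r : ofR S (- r) = - ofR S r.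
Proof. by apply/eqP; rewrite -addr_eq0 -ofRD addNr ofR0. Qed.

(** Stated with an inequality because it is applied after bounding the modulus by every positive
    [e]. *)
Lemma absK_le0 z : absK S z <= 0 -> z = 0.
Proof.
move: z; case: hS => -> /= z; first by rewrite normr_le0 => /eqP.
move=> h; apply: Normc.eq0_normc; apply/eqP; rewrite eq_le h /=.
by case: z {h} => a b; exact: sqrtr_ge0.
Qed.

Lemma absKD z w : absK S (z + w) <= absK S z + absK S w.
Proof.
move: z w; case: hS => -> /= z w; first exact: ler_normD.
by rewrite -lecR rmorphD; exact: (ler_normD z w).
Qed.

(** Both integrals in [Kint] are real, so taking real parts removes the one multiplied by [iK];
    scalar-valued pairings thus become real integrals of [rip]. *)
Lemma reK_Kint (g : R -> K S) :
  reK S (Kint g) = Rintegral lebesgue_measure [set: R] (fun t => reK S (g t)).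
Proof.
rewrite /Kint; move: g; case: hS => -> g /=; first by rewrite mul0r addr0.
by rewrite !mul0r mul1r subr0 addr0.
Qed.

End ScalarLaws.

Section RealInner.
Context {R : realType} {S : Scalars R} (hS : S = RealS R \/ S = CplxS R).
Context {H : lmodType (K S)} {inner : H -> H -> K S} (hH : is_hilbert inner).
Implicit Types (x y z : H) (a : R).

Definition rip x y : R := reK S (inner x y).
Notation N := (normH inner).

Lemma ripDr x y z : rip x (y + z) = rip x y + rip x z.
Proof.
have [+ _ _ _ _] := hH => /(_ x y z 1).
by rewrite scale1r mul1r /rip => ->; rewrite (reKD hS).
Qed.

Lemma ripC x y : rip x y = rip y x.
Proof. by have [_ h _ _ _] := hH; rewrite /rip h (reK_conj hS). Qed.

Lemma ripDl x y z : rip (x + y) z = rip x z + rip y z.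
Proof. by rewrite ripC ripDr !(ripC z). Qed.

Lemma rip0r x : rip x 0 = 0.
Proof. by have := ripDr x 0 0; rewrite addr0 => /eqP; rewrite -subr_eq subrr => /eqP. Qed.

Lemma rip0l x : rip 0 x = 0.
Proof. by rewrite ripC rip0r. Qed.

Lemma ripZr x y a : rip x (ofR S a *: y) = a * rip x y.
Proof.
have [+ _ _ _ _] := hH => /(_ x y 0 (ofR S a)).
rewrite addr0 {1}/rip => ->; rewrite (reKD hS) (reK_ofRM hS) -/(rip x 0) rip0r.
by rewrite addr0.
Qed.

Lemma ripZl x y a : rip (ofR S a *: x) y = a * rip x y.
Proof. by rewrite ripC ripZr ripC. Qed.

Lemma ripNr x y : rip x (- y) = - rip x y.
Proof. by apply/eqP; rewrite -addr_eq0 -ripDr addNr rip0r. Qed.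

Lemma ripNl x y : rip (- x) y = - rip x y.
Proof. by rewrite ripC ripNr ripC. Qed.

Lemma rip_ge0 x : 0 <= rip x x.
Proof.
have [_ _ h _ _] := hH; have [r [r0 hr]] := h x.
by rewrite /rip hr (reK_ofR hS).
Qed.

Lemma normH_ge0 x : 0 <= N x.
Proof. exact: sqrtr_ge0. Qed.

Lemma normH_sq x : N x ^+ 2 = rip x x.
Proof. by rewrite sqr_sqrtr// rip_ge0. Qed.

Lemma normH_eq0 x : N x = 0 -> x = 0.
Proof.
move=> Nx0; have := normH_sq x; rewrite Nx0 expr0n /=.
have [_ _ h hz _] := hH; have [r [r0 hr]] := h x.
rewrite /rip hr (reK_ofR hS) => r0'; apply: hz.
by rewrite hr -r0' (ofR0 hS).
Qed.

Lemma normH0 : N 0 = 0.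
Proof. by rewrite /normH -/(rip 0 0) rip0r sqrtr0. Qed.

Lemma normHZ a x : N (ofR S a *: x) = `|a| * N x.
Proof.
rewrite /normH -!/(rip _ _) ripZl ripZr mulrA -expr2 sqrtrM ?sqr_ge0//.
by rewrite sqrtr_sqr.
Qed.

Lemma normHN x : N (- x) = N x.
Proof. by rewrite /normH -!/(rip _ _) ripNl ripNr opprK. Qed.

Lemma rip_CS x y : `|rip x y| <= N x * N y.
Proof.
have [/normH_eq0 ->|Ny0] := eqVneq (N y) 0.
  by rewrite rip0r normr0 normH0 mulr0.
have B0 : 0 < rip y y by rewrite -normH_sq exprn_gt0// lt0r Ny0 normH_ge0.
rewrite -ler_sqr ?nnegrE ?mulr_ge0 ?normH_ge0//.
rewrite real_normK ?num_real// exprMn !normH_sq.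
(* This vector is [B] times the component of [x] orthogonal to [y]; its squared norm is
   [B * (A * B - b ^+ 2)]. *)
have := rip_ge0 (ofR S (rip y y) *: x - ofR S (rip x y) *: y).
rewrite !(ripDl, ripDr, ripNl, ripNr, ripZl, ripZr) (ripC y x).
set A := rip x x; set B := rip y y in B0 *; set b := rip x y.
suff -> : B * (B * A - b * b) - b * (B * b - b * B) =
         B * (A * B - b ^+ 2) by rewrite pmulr_rge0// subr_ge0.
by ring.
Qed.

Lemma normHD x y : N (x + y) <= N x + N y.
Proof.
rewrite -ler_sqr ?nnegrE ?addr_ge0 ?normH_ge0// sqrrD !normH_sq.
rewrite ripDl !ripDr (ripC y x).
have := le_trans (ler_norm _) (rip_CS x y); lra.
Qed.

Lemma normHB x y : N (x - y) <= N x + N y.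
Proof. by rewrite -(normHN y) normHD. Qed.

(** The parallelogram identity with the square of [N (x - y)] dropped. Being quadratic, it
    integrates directly and takes the place of the triangle inequality for weighted norms. *)
Lemma normHD_sq x y : N (x + y) ^+ 2 <= 2 * N x ^+ 2 + 2 * N y ^+ 2.
Proof.
have := rip_ge0 (x - y); rewrite !normH_sq.
by rewrite !(ripDl, ripDr, ripNl, ripNr) (ripC y x); lra.
Qed.

Lemma rip_le_sq x y : `|rip x y| <= N x ^+ 2 + N y ^+ 2.
Proof.
apply: le_trans (rip_CS x y) _.
have := sqr_ge0 (N x - N y); have := sqr_ge0 (N x + N y); rewrite !sqrrD sqrrN mulrN.
by rewrite mulr2n; lra.
Qed.

(** * Derivatives of vector-valued functions *)

Lemma hasderivHD (f g : R -> H) t u v : hasderivH inner f t u -> hasderivH inner g t v ->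
  hasderivH inner (fun s => f s + g s) t (u + v).
Proof.
rewrite /hasderivH => hf hg.
apply: (@squeeze_cvgr _ _ _ _ (fun=> 0) (fun h : R =>
   N (ofR S h^-1 *: (f (t + h) - f t) - u) + N (ofR S h^-1 *: (g (t + h) - g t) - v))).
- near=> h; rewrite normH_ge0 /=.
  apply: le_trans (normHD _ _).
  rewrite le_eqVlt; apply/orP; left; apply/eqP; congr (N _).
  rewrite addrACA -opprD -scalerDr; congr (_ *: _ - _).
  by rewrite addrACA -opprD.
- exact: cvg_cst.
- by rewrite -[X in _ --> X](addr0 0); exact: cvgD.
Unshelve. all: by end_near. Qed.

Lemma hasderivHZ (g : R -> R) (l t : R) (c : H) : is_derive t 1 g l ->
  hasderivH inner (fun s => ofR S (g s) *: c) t (ofR S l *: c).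
Proof.
move=> /is_derive1P dg; rewrite /hasderivH.
have -> : (fun h : R => N (ofR S h^-1 *: (ofR S (g (t + h)) *: c - ofR S (g t) *: c)
                            - ofR S l *: c)) =
          (fun h : R => `|h^-1 * (g (t + h) - g t) - l| * N c).
  apply/funext => h; rewrite -normHZ; congr (N _).
  rewrite !(ofRD hS, ofRN hS, ofRM hS) -[in LHS]scaleNr -[in LHS]scalerDl scalerA.
  by rewrite -scaleNr -scalerDl.
rewrite -[X in _ --> X](mul0r (N c)); apply: cvgMl.
rewrite -[X in _ --> X](normr0 R); apply: cvg_norm.
by rewrite -[X in _ --> X](subrr l); apply: cvgB => //; exact: cvg_cst.
Qed.

Lemma hasderivH_cst (c : H) t : hasderivH inner (fun=> c) t 0.
Proof.
rewrite /hasderivH; have -> : (fun h : R => N (ofR S h^-1 *: (c - c) - 0)) = cst 0.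
  by apply/funext => h; rewrite subrr scaler0 subr0 normH0.
exact: cvg_cst.
Qed.

(** * Strong measurability *)

Definition chop (A : set R) (f : R -> H) (t : R) : H := if `[< A t >] then f t else 0.

Lemma rip_suml (I : Type) (r : seq I) (P : pred I) (F : I -> H) y :
  rip (\sum_(i <- r | P i) F i) y = \sum_(i <- r | P i) rip (F i) y.
Proof.
apply: (big_morph (rip^~ y) (id1 := 0) (op1 := +%R)); last exact: rip0l.
by move=> u v; rewrite ripDl.
Qed.

Lemma rip_sumr (I : Type) (r : seq I) (P : pred I) (F : I -> H) y :
  rip y (\sum_(i <- r | P i) F i) = \sum_(i <- r | P i) rip y (F i).
Proof. by rewrite ripC rip_suml; apply: eq_bigr => i _; rewrite ripC. Qed.

Notation simple := (@simpleH R S H).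
Notation smeas := (strongly_measurable inner).

(** The pairing of two simple functions is a finite combination of products of indicators. No
    sigma-algebra on [H] enters: real measurability is obtained here and passed to limits in
    [smeas_rip]. *)
Lemma simple_rip (f g : R -> H) : simple f -> simple g ->
  measurable_fun setT (fun t => rip (f t) (g t)).
Proof.
move=> [n [A [c [mA fE]]]] [m [B [d [mB gE]]]].
have -> : (fun t => rip (f t) (g t)) =
    (fun t => \sum_(i < n) \sum_(j < m) (\1_(A i) t * \1_(B j) t * rip (c i) (d j))).
  apply/funext => t; rewrite fE gE rip_suml [LHS]big_mkcond; apply: eq_bigr => i _.
  rewrite indicE; case: asboolP => At.
    rewrite mem_set// rip_sumr [LHS]big_mkcond; apply: eq_bigr => j _.
    rewrite indicE; case: asboolP => Bt; first by rewrite mem_set// !mul1r.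
    by rewrite memNset// mulr0 mul0r.
  by rewrite memNset// big1// => j _; rewrite !mul0r.
apply: measurable_sum => i; apply: measurable_sum => j.
apply: measurable_funM => //; apply: measurable_funM; exact: measurable_indic.
Qed.

Lemma simple0 : simple (fun=> 0).
Proof.
exists 0%N, (fun _ => set0), (fun _ => 0); split=> [[]//|t].
by rewrite big_ord0.
Qed.

Lemma simpleD (f g : R -> H) : simple f -> simple g -> simple (fun t => f t + g t).
Proof.
move=> [n [A [c [mA fE]]]] [m [B [d [mB gE]]]].
exists (n + m)%N, (fun i => match fintype.split i with inl a => A a | inr b => B b end),
  (fun i => match fintype.split i with inl a => c a | inr b => d b end); split.
  by move=> i; case: fintype.split.
move=> t; rewrite big_split_ord /= fE gE; congr (_ + _).
  apply: eq_big => i; first by rewrite (unsplitK (inl _ i)).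
  by rewrite (unsplitK (inl _ i)).
apply: eq_big => i; first by rewrite (unsplitK (inr _ i)).
by rewrite (unsplitK (inr _ i)).
Qed.

Lemma simpleZ (f : R -> H) (a : R) : simple f -> simple (fun t => ofR S a *: f t).
Proof.
move=> [n [A [c [mA fE]]]]; exists n, A, (fun i => ofR S a *: c i); split=> // t.
by rewrite fE scaler_sumr.
Qed.

Lemma simple_chop (f : R -> H) (B : set R) : measurable B -> simple f -> simple (chop B f).
Proof.
move=> mB [n [A [c [mA fE]]]]; exists n, (fun i => A i `&` B), c; split.
  by move=> i; exact: measurableI.
move=> t; rewrite /chop; case: asboolP => Bt.
  by rewrite fE; apply: eq_bigl => i; apply: asbool_equiv_eq; split=> [|[]].
by rewrite big_pred0// => i; apply/asboolP => -[].
Qed.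

Lemma simple_cst (c : H) : simple (fun=> c).
Proof.
exists 1%N, (fun _ => setT), (fun=> c); split=> // t.
by rewrite (eq_bigl xpredT) ?big_ord1// => i; apply/asboolP.
Qed.

(** Decomposes along the level sets of [h], which has finite range; at [t] only the term for the
    value [h t] survives. *)
Lemma simple_sfun (h : {sfun R >-> R}) (c : H) : simple (fun t => ofR S (h t) *: c).
Proof.
have -> : (fun t => ofR S (h t) *: c) =
   (fun t => \sum_(y <- finmap.enum_fset (fset_set (range h)))
     chop (h @^-1` [set y]) (fun=> ofR S y *: c) t).
  apply/funext => t.
  have ht : h t \in finmap.enum_fset (fset_set (range h)).
    by rewrite in_fset_set ?mem_set//.
  rewrite (bigD1_seq (h t)) ?finmap.fset_uniq//= big1 ?addr0.
    by rewrite /chop asboolT.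
  by move=> y yt; rewrite /chop; case: asboolP => // ty; rewrite -ty eqxx in yt.
(* The enumeration of the range is generalized to an arbitrary list to allow induction. *)
have : forall (s : seq R), simple (fun t =>
    \sum_(y <- s) chop (h @^-1` [set y]) (fun=> ofR S y *: c) t).
  elim=> [|y s IH].
    by under eq_fun do rewrite big_nil; exact: simple0.
  under eq_fun do rewrite big_cons; apply: simpleD => //.
  by apply: simple_chop => //; exact: simple_cst.
exact.
Qed.

Lemma smeas_simple (f : R -> H) : simple f -> smeas f.
Proof.
move=> sf; exists (fun=> f); split=> // t.
by under eq_fun do rewrite subrr normH0; exact: cvg_cst.
Qed.

Lemma smeasD (f g : R -> H) : smeas f -> smeas g -> smeas (fun t => f t + g t).
Proof.
move=> [u [su uf]] [v [sv vg]]; exists (fun k t => u k t + v k t); split.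
  by move=> k; exact: simpleD.
move=> t; apply: (@squeeze_cvgr _ _ _ _ (fun=> 0)
  (fun k => N (u k t - f t) + N (v k t - g t))).
- by near=> k; rewrite normH_ge0/= opprD addrACA normHD.
- exact: cvg_cst.
- by rewrite -[X in _ --> X](addr0 0); apply: cvgD; [exact: uf|exact: vg].
Unshelve. all: by end_near. Qed.

Lemma smeasZ (f : R -> H) (a : R) : smeas f -> smeas (fun t => ofR S a *: f t).
Proof.
move=> [u [su uf]]; exists (fun k t => ofR S a *: u k t); split.
  by move=> k; exact: simpleZ.
move=> t; rewrite (_ : (fun k => _) = (fun k => `|a| * N (u k t - f t))); last first.
  by apply/funext => k; rewrite -scalerBr normHZ.
by rewrite -[X in _ --> X](mulr0 `|a|); apply: cvgMr; exact: uf.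
Qed.

Lemma smeasN (f : R -> H) : smeas f -> smeas (fun t => - f t).
Proof. by move=> /(smeasZ _ (-1)); under eq_fun do rewrite (ofRN hS) (ofR1 hS) scaleN1r. Qed.

Lemma smeasB (f g : R -> H) : smeas f -> smeas g -> smeas (fun t => f t - g t).
Proof. by move=> sf /smeasN; exact: smeasD. Qed.

Lemma smeas_chop (f : R -> H) (B : set R) : measurable B -> smeas f -> smeas (chop B f).
Proof.
move=> mB [u [su uf]]; exists (fun k => chop B (u k)); split.
  by move=> k; exact: simple_chop.
move=> t; rewrite /chop; case: asboolP => _; first exact: uf.
by under eq_fun do rewrite subrr normH0; exact: cvg_cst.
Qed.

(** Real simple approximants of [g] multiplied by [c] do the job, since the error is only scaled by
    [N c]. *)
Lemma smeas_scal (g : R -> R) (c : H) : measurable_fun setT g ->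
  smeas (fun t => ofR S (g t) *: c).
Proof.
move=> /measurable_EFinP mg.
have [h hg] := approximation_sfun measurableT mg.
exists (fun k t => ofR S (h k t) *: c); split; first by move=> k; exact: simple_sfun.
move=> t; rewrite (_ : (fun k => _) = (fun k => `|h k t - g t| * N c)); last first.
  by apply/funext => k; rewrite -scaleNr -(ofRN hS) -scalerDl -(ofRD hS) normHZ.
rewrite -[X in _ --> X](mul0r (N c)); apply: cvgMl.
rewrite -[X in _ --> X](normr0 R); apply: cvg_norm.
rewrite -[X in _ --> X](subrr (g t)); apply: cvgB; last exact: cvg_cst.
by have /fine_cvgP[_] := hg t I.
Qed.

Lemma cvg_rip (u v : nat -> H) (x y : H) :
  (fun k => N (u k - x)) @ \oo --> (0 : R) -> (fun k => N (v k - y)) @ \oo --> (0 : R) ->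
  (fun k => rip (u k) (v k)) @ \oo --> rip x y.
Proof.
move=> ux vy.
apply/subr_cvg0.
apply: norm_cvg0; apply: (@squeeze_cvgr _ _ _ _ (fun=> 0) (fun k =>
  N (u k - x) * N (v k - y) + N (u k - x) * N y + N x * N (v k - y))).
- near=> k; rewrite normr_ge0 /=.
  have -> : rip (u k) (v k) - rip x y =
      rip (u k - x) (v k - y) + rip (u k - x) y + rip x (v k - y).
    by rewrite !(ripDl, ripDr, ripNl, ripNr); ring.
  apply: le_trans (ler_normD _ _) _; apply: lerD; last exact: rip_CS.
  by apply: le_trans (ler_normD _ _) _; apply: lerD; exact: rip_CS.
- exact: cvg_cst.
- rewrite -[X in _ --> X](_ : 0 * 0 + 0 * N y + N x * 0 = 0); last by ring.
  by apply: cvgD; [apply: cvgD; [exact: cvgM|exact: cvgMl]|exact: cvgMr].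
Unshelve. all: by end_near. Qed.

Lemma smeas_rip (f g : R -> H) : smeas f -> smeas g ->
  measurable_fun setT (fun t => rip (f t) (g t)).
Proof.
move=> [u [su uf]] [v [sv vg]].
apply: (@measurable_fun_cvg _ _ _ _ (fun k t => rip (u k t) (v k t))).
  by move=> k; exact: simple_rip.
by move=> t _; apply: cvg_rip; [exact: uf|exact: vg].
Qed.

(** * Weighted square integrability and test functions *)

Notation mu := (@lebesgue_measure R).
Notation L2w := (L2w inner).
Notation wint := (wint inner).
Implicit Types (rho : R) (f g : R -> H) (J : set R).

Lemma ae_imply (P Q : R -> Prop) : (forall t, P t -> Q t) ->
  {ae mu, forall t, P t} -> {ae mu, forall t, Q t}.
Proof. by move=> PQ; exact: (@filterS _ _ (ae_filter_ringOfSetsType mu)). Qed.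

Definition weight rho (t : R) : R := expR (- (2 * rho * t)).

Lemma weight_gt0 rho t : 0 < weight rho t.
Proof. exact: expR_gt0. Qed.

Lemma smooth_weight rho : smooth (weight rho).
Proof.
move=> n; have -> : weight rho = (fun t => expR (- (2 * rho) * t + 0)).
  by apply/funext => t; rewrite addr0 mulNr.
by apply: ndiff_affine; exact: smooth_expR.
Qed.

Lemma measurable_weight rho : measurable_fun setT (weight rho).
Proof. by apply: continuous_measurable_fun; apply: smooth_continuous; exact: smooth_weight. Qed.

Lemma measurable_wnormsq rho f : smeas f ->
  measurable_fun setT (fun t => N (f t) ^+ 2 * weight rho t).
Proof.
move=> sf; apply: measurable_funM; last exact: measurable_weight.
by under eq_fun do rewrite normH_sq; exact: smeas_rip.
Qed.

Lemma measurable_wnormsqE rho f : smeas f ->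
  measurable_fun setT (fun t => (N (f t) ^+ 2 * weight rho t)%:E).
Proof. by move=> sf; apply/measurable_EFinP; exact: measurable_wnormsq. Qed.

Lemma wnormsq_ge0 rho f t : (0 <= (N (f t) ^+ 2 * weight rho t)%:E)%E.
Proof. by rewrite lee_fin mulr_ge0 ?sqr_ge0// ltW// weight_gt0. Qed.

Lemma wint_ge0 rho f : (0 <= wint rho f)%E.
Proof. by apply: integral_ge0 => t _; exact: wnormsq_ge0. Qed.

Lemma wint0 rho : wint rho (fun=> 0) = 0%E.
Proof.
by rewrite /Defs.wint; under eq_integral do rewrite normH0 expr0n /= mul0r; rewrite integral0.
Qed.

Lemma wintN rho f : wint rho (fun t => - f t) = wint rho f.
Proof. by rewrite /Defs.wint; under eq_integral do rewrite normHN. Qed.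

(** Integrates [normHD_sq]. The factor 2 is harmless, as [wint] of a sum only has to be made
    small. *)
Lemma wintD rho f g : smeas f -> smeas g ->
  (wint rho (fun t => f t + g t)%R <= 2%:E * wint rho f + 2%:E * wint rho g)%E.
Proof.
move=> sf sg.
rewrite /Defs.wint -!ge0_integralZl ?lee_fin//; try (by move=> t _; exact: wnormsq_ge0);
  try exact: measurable_wnormsqE.
have fg0 (k : R -> H) t : (0 <= 2%:E * (N (k t) ^+ 2 * weight rho t)%:E)%E.
  by rewrite mule_ge0 ?lee_fin// mulr_ge0 ?sqr_ge0 ?expR_ge0.
have mfg (k : R -> H) : smeas k ->
    measurable_fun setT (fun t => (2%:E * (N (k t) ^+ 2 * weight rho t)%:E)%E).
  by move=> sk; apply: measurable_funeM; exact: measurable_wnormsqE.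
rewrite -ge0_integralD//; try exact: mfg; try by move=> t _; exact: fg0.
apply: ge0_le_integral => //.
- by move=> t _; exact: (wnormsq_ge0 _ (fun t => f t + g t)).
- by apply: (measurable_wnormsqE _ (fun t => f t + g t)); exact: smeasD.
- by apply: emeasurable_funD; exact: mfg.
- move=> t _; rewrite -!EFinM -EFinD lee_fin; have := normHD_sq (f t) (g t).
  move=> /(ler_wpM2r (expR_ge0 (- (2 * rho * t)))).
  by lra.
Qed.

Lemma wint_ae rho f g : smeas f -> smeas g -> {ae mu, forall t, f t = g t} ->
  wint rho f = wint rho g.
Proof.
move=> sf sg fg; apply: ae_eq_integral => //; try exact: measurable_wnormsqE.
by apply: ae_imply fg => t ft _; rewrite ft.
Qed.

Lemma wint_dominated rho (u : nat -> R -> H) f (G : R -> R) :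
  (forall k, smeas (u k)) -> smeas f ->
  (forall t, (fun k => N (u k t - f t)) @ \oo --> (0 : R)) ->
  (forall k t, N (u k t - f t) ^+ 2 <= G t) ->
  mu.-integrable setT (fun t => (G t * weight rho t)%:E) ->
  (fun k => wint rho (fun t => u k t - f t)) @ \oo --> 0%E.
Proof.
move=> su sf uf uG iG.
have -> : 0%E = (\int[mu]_(t in setT) (fun=> 0) t)%E by rewrite integral0.
apply: (dominated_cvg measurableT _ _ _ iG) => //.
- by move=> k; apply: (measurable_wnormsqE _ (fun t => u k t - f t)); exact: smeasB.
- move=> t _; apply/cvg_EFin; first by near=> k.
  rewrite /comp /= -[X in _ --> X](mul0r (weight rho t)); apply: cvgMl.
  rewrite -[X in _ --> X](mulr0 0); apply: cvgM; exact: uf.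
- move=> k t _; rewrite gee0_abs; last exact: (wnormsq_ge0 _ (fun t => u k t - f t)).
  by rewrite lee_fin ler_wpM2r// expR_ge0.
Unshelve. all: by end_near. Qed.

Lemma L2wD rho f g : L2w rho f -> L2w rho g -> L2w rho (fun t => f t + g t).
Proof.
move=> [sf wf] [sg wg]; split; first exact: smeasD.
apply: le_lt_trans (wintD _ _ _ sf sg) _.
by rewrite lte_add_pinfty// lte_mul_pinfty// ?lee_fin//; rewrite fin_numE.
Qed.

Lemma L2wN rho f : L2w rho f -> L2w rho (fun t => - f t).
Proof. by move=> [sf wf]; split; [exact: smeasN | rewrite wintN]. Qed.

Lemma L2wB rho f g : L2w rho f -> L2w rho g -> L2w rho (fun t => f t - g t).
Proof. by move=> hf /L2wN; exact: L2wD. Qed.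

(** The bounded interval gives compact support, while [J] separately records the side of the line,
    typically a half-line, on which [h] may live. *)
Definition cutoff J (h : R -> R) := [/\ smooth h,
  exists al be, forall t, ~~ (al < t < be) -> h t = 0 & forall t, ~ J t -> h t = 0].

(** Finite sums of scalar cutoffs times fixed vectors, the algebraic tensor product. Derivatives,
    primitives and integrability then reduce to real functions by induction. *)
Inductive testf J : (R -> H) -> Prop :=
| testf0 : testf J (fun=> 0)
| testfS h c f : cutoff J h -> testf J f -> testf J (fun t => ofR S (h t) *: c + f t).

Lemma cutoff_smeas J h c : cutoff J h -> smeas (fun t => ofR S (h t) *: c).
Proof.
move=> [sh _ _]; apply: smeas_scal; apply: continuous_measurable_fun.
exact: smooth_continuous.
Qed.

Lemma cutoffM J h k : smooth k -> cutoff J h -> cutoff J (fun t => k t * h t).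
Proof.
move=> sk [sh [al [be hab]] hJ]; split.
- by move=> n; exact: ndiffM.
- by exists al, be => t tn; rewrite hab// mulr0.
- by move=> t tJ; rewrite hJ// mulr0.
Qed.

Lemma cutoff_integrable J h : cutoff J h -> mu.-integrable setT (EFin \o h).
Proof.
by move=> [sh [al [be hab]] _]; apply: (cpt_integrable _ al be) => //; exact: smooth_continuous.
Qed.

Lemma cutoff_L2w J h c rho : cutoff J h -> L2w rho (fun t => ofR S (h t) *: c).
Proof.
move=> ch; split; first exact: cutoff_smeas ch.
(* The weighted squared norm is itself a cutoff, hence integrable. *)
have ck : cutoff J (fun t => N c ^+ 2 * (weight rho t * (h t * h t))).
  apply: (cutoffM J _ (fun=> N c ^+ 2)); first by move=> n; exact: ndiff_cst.
  apply: cutoffM; first exact: smooth_weight.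
  by apply: cutoffM => //; case: ch.
have /integrableP[_] := cutoff_integrable _ _ ck.
rewrite /Defs.wint; under eq_integral => t _.
  rewrite gee0_abs; last first.
    by rewrite lee_fin mulr_ge0 ?sqr_ge0// mulr_ge0 ?expR_ge0// -expr2 sqr_ge0.
  over.
apply: le_lt_trans; rewrite le_eqVlt; apply/orP; left; apply/eqP.
apply: eq_integral => t _; congr (_%:E); rewrite normHZ exprMn real_normK ?num_real//.
by rewrite -/(weight rho t); ring.
Qed.

Lemma testf_L2w J f rho : testf J f -> L2w rho f.
Proof.
elim=> {f} [|h c f ch _ IH]; last by apply: L2wD => //; exact: cutoff_L2w ch.
by split; [apply: smeas_simple; exact: simple0 | rewrite wint0].
Qed.

Lemma testf_smeas J f : testf J f -> smeas f.
Proof. by move/(testf_L2w _ _ 0) => []. Qed.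

Lemma testfD J f g : testf J f -> testf J g -> testf J (fun t => f t + g t).
Proof.
move=> tf tg; elim: tf => {f} [|h c f ch _ IH].
  by under eq_fun do rewrite add0r.
by under eq_fun do rewrite -addrA; exact: testfS.
Qed.

Lemma testfZ J f k : smooth k -> testf J f -> testf J (fun t => ofR S (k t) *: f t).
Proof.
move=> sk; elim=> {f} [|h c f ch _ IH].
  by under eq_fun do rewrite scaler0; exact: testf0.
under eq_fun do rewrite scalerDr scalerA -(ofRM hS).
by apply: testfS => //; exact: cutoffM.
Qed.

Lemma testfN J f : testf J f -> testf J (fun t => - f t).
Proof.
move=> tf; have -> : (fun t => - f t) = (fun t => ofR S (-1) *: f t).
  by apply/funext => t; rewrite (ofRN hS) (ofR1 hS) scaleN1r.
by apply: (testfZ J f (fun=> -1)) => // n; exact: ndiff_cst.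
Qed.

Lemma testfB J f g : testf J f -> testf J g -> testf J (fun t => f t - g t).
Proof. by move=> tf /testfN; exact: testfD. Qed.

Lemma testf_out J f t : testf J f -> ~ J t -> f t = 0.
Proof.
move=> tf nJ; elim: tf => // {}h c {}f [_ _ hJ] _ ->.
by rewrite hJ// (ofR0 hS) scale0r addr0.
Qed.

Lemma testfW J J' f : J `<=` J' -> testf J f -> testf J' f.
Proof.
move=> JJ'; elim=> [|h c {}f [sh hab hJ] _ IH]; first exact: testf0.
by apply: testfS => //; split=> // t nJ; apply: hJ => /JJ'.
Qed.

Lemma testf_Cc J f : testf J f -> Cc inner f.
Proof.
elim=> {f} [|h c f [sh [al [be hab]] _] _ [D [D0 [sD [a [b fab]]]]]].
  exists (fun _ _ => 0); split=> //; split; last by exists 0, 0.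
  by move=> n t; exact: hasderivH_cst.
have [E [E0 dE]] := smooth_derivatives _ sh.
exists (fun n t => ofR S (E n t) *: c + D n t); split; first by rewrite E0 D0.
split; first by move=> n t; apply: hasderivHD => //; exact: hasderivHZ.
exists (Num.min a al), (Num.max b be) => t ht.
have hta : t < a \/ b < t.
  by case: ht; rewrite ?lt_min ?gt_max => /andP[]; [left|right].
have htal : ~~ (al < t < be).
  by case: ht; rewrite ?lt_min ?gt_max => /andP[_ h2]; rewrite negb_and -!leNgt (ltW h2) ?orbT.
by rewrite fab// hab// (ofR0 hS) scale0r addr0.
Qed.

Lemma cutoff_bump J al be k : (forall t, al < t < be -> J t) -> cutoff J (bump al be k).
Proof.
move=> hJ; split; first exact: smooth_bump.
  by exists al, be => t; exact: bump_out.
by move=> t nJ; apply: bump_out; apply/negP => /hJ.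
Qed.

(** * Density of the test functions *)

(** The quarter compensates the two factors 2 of [wintD]. *)
Lemma wintD_lt rho f g (e : R) : smeas f -> smeas g ->
  (wint rho f < (e / 4)%:E)%E -> (wint rho g < (e / 4)%:E)%E ->
  (wint rho (fun t => f t + g t)%R < e%:E)%E.
Proof.
move=> sf sg fe ge; apply: le_lt_trans (wintD _ _ _ sf sg) _.
have -> : e%:E = (2%:E * (e / 4)%:E + 2%:E * (e / 4)%:E)%E.
  by rewrite -!EFinM -EFinD; congr (_%:E); field.
by apply: lteD; rewrite lte_pmul2l ?lte_fin.
Qed.

(** Membership in the closure of [testf J] for the weighted norm. The squared norm is kept in the
    extended reals, so the bound by [e] includes finiteness. *)
Definition approx rho J f := forall e : R, 0 < e ->
  exists phi, testf J phi /\ (wint rho (fun t => f t - phi t)%R < e%:E)%E.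

Lemma approx_testf rho J f : testf J f -> approx rho J f.
Proof.
move=> tf e e0; exists f; split=> //.
by under [X in wint _ X]eq_fun do rewrite subrr; rewrite wint0 lte_fin.
Qed.

Lemma approxD rho J f g : smeas f -> smeas g -> approx rho J f -> approx rho J g ->
  approx rho J (fun t => f t + g t).
Proof.
move=> sf sg af ag e e0; have e4 : 0 < e / 4 by rewrite divr_gt0.
have [phi [tphi pe]] := af _ e4; have [psi [tpsi qe]] := ag _ e4.
exists (fun t => phi t + psi t); split; first exact: testfD.
under [X in wint _ X]eq_fun do rewrite opprD addrACA.
have sphi := testf_smeas _ _ tphi; have spsi := testf_smeas _ _ tpsi.
by apply: wintD_lt => //; exact: smeasB.
Qed.

Lemma approxB rho J f g : smeas f -> smeas g -> approx rho J f -> approx rho J g ->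
  approx rho J (fun t => f t - g t).
Proof.
move=> sf sg af ag; apply: approxD => //; first exact: smeasN.
move=> e e0; have [phi [tphi pe]] := ag _ e0.
exists (fun t => 0 - phi t); split; first by apply: testfB => //; exact: testf0.
by under [X in wint _ X]eq_fun do rewrite sub0r -opprD; rewrite wintN.
Qed.

Lemma approx_lim rho J (u : nat -> R -> H) f :
  (forall k, smeas (u k)) -> smeas f -> (forall k, approx rho J (u k)) ->
  (fun k => wint rho (fun t => u k t - f t)) @ \oo --> 0%E -> approx rho J f.
Proof.
move=> su sf au uf e e0; have e4 : 0 < e / 4 by rewrite divr_gt0.
have [k uk] : exists k, (wint rho (fun t => u k t - f t)%R < (e / 4)%:E)%E.
  have /fine_cvgP[fu cu] := uf.
  have [k1 _ h1] := fu; have /cvgr0Pnorm_lt/(_ _ e4)[k2 _ h2] := cu.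
  (* Beyond [k1] the integral is finite; beyond [k2] its real value is below [e / 4]. *)
  exists (maxn k1 k2).
  rewrite -[X in (X < _)%E](@fineK R) ?lte_fin; last exact: (h1 _ (leq_maxl _ _)).
  exact: le_lt_trans (ler_norm _) (h2 _ (leq_maxr _ _)).
have [phi [tphi pe]] := au k _ e4; exists phi; split=> //.
have -> : (fun t => f t - phi t) = (fun t => - (u k t - f t) + (u k t - phi t)).
  by apply/funext => t; rewrite opprB addrA subrK.
have sphi := testf_smeas _ _ tphi.
by apply: wintD_lt; rewrite ?wintN//; [apply: smeasN|]; exact: smeasB.
Qed.

Definition window (al be : R) : set R := [set t | al < t < be].

Lemma measurable_window al be : measurable (window al be).
Proof.
have -> : window al be = `]al, be[%classic; last exact: measurable_itv.
by apply/seteqP; split=> t; rewrite /= in_itv.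
Qed.

Lemma window_integrable rho al be (C : R) : mu.-integrable setT
  (fun t => ((if al < t < be then C else 0) * weight rho t)%:E).
Proof.
have h : mu.-integrable (window al be) (EFin \o (fun t => C * weight rho t)).
  have h : mu.-integrable `[al, be] (EFin \o (fun t => C * weight rho t)).
    apply: (@continuous_compact_integrable R (fun t => C * weight rho t)).
      exact: segment_compact.
    apply: continuous_subspaceT; apply: smooth_continuous => n.
    by apply: (ndiffM n (fun=> C)); [exact: ndiff_cst | exact: smooth_weight].
  apply: integrableS h => //; first exact: measurable_window.
  by move=> t /andP[h1 h2]; rewrite /= in_itv /= !ltW.
have mw : @measurable _ (measurableTypeR R) (window al be) := measurable_window al be.
have := (integrable_mkcond _ mw).1 h.
congr (mu.-integrable _ _); apply/funext => t; rewrite patchE /=.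
have [tw|tw] := boolP (al < t < be); first by rewrite mem_set.
by rewrite memNset ?mul0r//; apply/negP.
Qed.

(** The bumps take values in the unit interval and vanish off the window, so dominated convergence
    applies with the bound [N c ^+ 2] on the window. *)
Lemma approx_window rho J al be c : (forall t, al < t < be -> J t) ->
  approx rho J (chop (window al be) (fun=> c)).
Proof.
move=> hJ; have cb := cutoff_bump J al be ^~ hJ.
have sw : smeas (chop (window al be) (fun=> c)).
  by apply: smeas_chop; [exact: measurable_window | apply: smeas_simple; exact: simple_cst].
apply: (@approx_lim _ _ (fun k t => ofR S (bump al be k t) *: c)) => //.
- by move=> k; exact: cutoff_smeas (cb k).
- move=> k; apply: approx_testf.
  by have := testfS J _ c _ (cb k) (testf0 J); under eq_fun do rewrite addr0.
have E k t : N (ofR S (bump al be k t) *: c - chop (window al be) (fun=> c) t) =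
    `|bump al be k t - (if al < t < be then 1 else 0)| * N c.
  rewrite -normHZ (ofRD hS) (ofRN hS) scalerDl scaleNr /chop; congr (N (_ - _)).
  case: asboolP => [->|/negP/negbTE ->]; first by rewrite (ofR1 hS) scale1r.
  by rewrite (ofR0 hS) scale0r.
apply: (wint_dominated _ _ _ (fun t => if al < t < be then N c ^+ 2 else 0)) => //.
- by move=> k; exact: cutoff_smeas (cb k).
- move=> t; rewrite (_ : (fun k => _) =
    (fun k => `|bump al be k t - (if al < t < be then 1 else 0)| * N c)); last first.
    by apply/funext => k; rewrite E.
  rewrite -[X in _ --> X](mul0r (N c)).
  apply: cvgMl; apply/norm_cvg0P/subr_cvg0; exact: cvg_bump.
- move=> k t; rewrite E; have [tw|tw] := boolP (al < t < be); last first.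
    by rewrite bump_out// subrr normr0 mul0r expr0n.
  rewrite exprMn real_normK ?num_real// -[leRHS]mul1r ler_wpM2r ?sqr_ge0//.
  by have := bump_ge0 al be k t; have := bump_le1 al be k t; nra.
- exact: window_integrable.
Qed.

(** Open rays []x, +oo[] are stable under intersection and generate the Borel sets, so it suffices
    that the good sets form a lambda-system containing them. Intersecting with a bounded window
    keeps all indicators square integrable, the whole line included. *)
Lemma approx_indicator rho J al be c (A : set R) : (forall t, al < t < be -> J t) ->
  measurable A -> approx rho J (chop (A `&` window al be) (fun=> c)).
Proof.
move=> hJ mA.
pose Lam := [set A : set R | measurable A /\
  approx rho J (chop (A `&` window al be) (fun=> c))].
have sAw B : measurable B -> smeas (chop (B `&` window al be) (fun=> c)).
  move=> mB; apply: smeas_chop; first by apply: measurableI => //; exact: measurable_window.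
  by apply: smeas_simple; exact: simple_cst.
suff : Lam A by case.
have : (@measurable _ (g_sigma_algebraType (@RGenOInfty.G R))) A.
  by rewrite -RGenOInfty.measurableE.
apply: (@lambda_system_subset _ (@RGenOInfty.G R) _ setT Lam) => //.
- move=> _ _ [x ->] [y ->]; exists (Num.max x y).
  by rewrite predeqE => t; rewrite /= !in_itv /= !andbT gt_max; split=> /andP.
- split=> //.
  + by split=> //; rewrite setTI; exact: approx_window.
  (* For nested sets the indicator of the difference is the difference of the indicators. *)
  + move=> B C CB [mB aB] [mC aC]; split; first exact: measurableD.
    have -> : chop ((B `\` C) `&` window al be) (fun=> c) =
        (fun t => chop (B `&` window al be) (fun=> c) t -
                  chop (C `&` window al be) (fun=> c) t).
      apply/funext => t; rewrite /chop.
      case: asboolP => [[[Bt Ct] wt]|h].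
        rewrite asboolT// asboolF ?subr0//; by move=> [].
      case: asboolP => [[Bt wt]|h']; last first.
        by rewrite asboolF ?subrr// => -[/CB Bt wt]; exact: h'.
      case: asboolP => [_|h']; first by rewrite subrr.
      by exfalso; apply: h; split=> //; split=> // Ct; exact: h'.
    by apply: approxB => //; exact: sAw.
  (* Along an increasing union the indicators are eventually constant at each point, and dominated
     convergence concludes. *)
  + move=> B ndB hB; split; first by apply: bigcup_measurable => k _; case: (hB k).
    apply: (approx_lim _ _ (fun k => chop (B k `&` window al be) (fun=> c))).
    * by move=> k; apply: sAw; case: (hB k).
    * by apply: sAw; apply: bigcup_measurable => k _; case: (hB k).
    * by move=> k; case: (hB k).
    apply: (wint_dominated _ _ _ (fun t => if al < t < be then N c ^+ 2 else 0)).
    * by move=> k; apply: sAw; case: (hB k).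
    * by apply: sAw; apply: bigcup_measurable => k _; case: (hB k).
    * move=> t; apply: cvg_near_cst.
      have [[[k0 _ Bt] wt]|h] := pselect ((\bigcup_k B k `&` window al be) t); last first.
        near=> k; rewrite /chop asboolF ?asboolF ?subrr ?normH0//.
        by move=> [Bk wt]; apply: h; split=> //; exists k.
      near=> k; rewrite /chop !asboolT ?subrr ?normH0//; first by split=> //; exists k0.
      split=> //.
      have /ndB/subsetPset : (k0 <= k)%N by near: k; exact: nbhs_infty_ge.
      exact.
    * move=> k t; rewrite /chop; case: asboolP => [[Bt wt]|h].
        by rewrite asboolT ?subrr ?normH0 ?expr0n/=;
          [case: ifP; rewrite ?sqr_ge0|split=> //; exists k].
      case: asboolP => [[_ wt]|_]; last first.
        by rewrite subrr normH0 expr0n /=; case: ifP; rewrite ?sqr_ge0.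
      by rewrite sub0r normHN ifT.
    * exact: window_integrable.
- move=> _ [x ->]; split; first exact: measurable_itv.
  have -> : `]x, +oo[%classic `&` window al be = window (Num.max x al) be.
    rewrite predeqE => t; rewrite /window /= in_itv /= andbT gt_max.
    by split=> [[-> /andP[-> ->]]|/andP[/andP[-> ->] ->]].
  by apply: approx_window => t /andP[]; rewrite gt_max => /andP[_ h1] h2; apply: hJ; rewrite h1.
Unshelve. all: by end_near. Qed.

(** The additional set [E] leaves room for truncating a simple function where it is too large. *)
Lemma approx_simple rho J al be (E : set R) g : (forall t, al < t < be -> J t) ->
  measurable E -> simple g -> approx rho J (chop (E `&` window al be) g).
Proof.
move=> hJ mE [n [A [c [mA gE]]]].
have -> : chop (E `&` window al be) g =
    (fun t => \sum_(i < n) chop ((E `&` A i) `&` window al be) (fun=> c i) t).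
  apply/funext => t; rewrite {1}/chop; case: asboolP => [[Et wt]|h].
    rewrite gE big_mkcond; apply: eq_bigr => i _; rewrite /chop.
    case: asboolP => At; first by rewrite asboolT.
    by rewrite asboolF// => -[[]].
  by rewrite big1// => i _; rewrite /chop asboolF// => -[[Et _] wt]; exact: h.
have mEA i : measurable (E `&` A i `&` window al be).
  by apply: measurableI; [exact: measurableI | exact: measurable_window].
have sEA i : smeas (chop (E `&` A i `&` window al be) (fun=> c i)).
  by apply: smeas_chop => //; apply: smeas_simple; exact: simple_cst.
(* Strong measurability is carried through the induction because [approxD] asks for it. *)
suff h (s : seq 'I_n) :
    smeas (fun t => \sum_(i <- s) chop ((E `&` A i) `&` window al be) (fun=> c i) t) /\
    approx rho J (fun t => \sum_(i <- s) chop ((E `&` A i) `&` window al be) (fun=> c i) t).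
  exact: (h _).2.
elim: s => [|i s [IHs IHa]].
  rewrite (_ : (fun t => _) = (fun=> 0)); last by apply/funext => t; rewrite big_nil.
  by split; [apply: smeas_simple; exact: simple0 | apply: approx_testf; exact: testf0].
rewrite (_ : (fun t => _) = (fun t => chop (E `&` A i `&` window al be) (fun=> c i) t +
  \sum_(i <- s) chop ((E `&` A i) `&` window al be) (fun=> c i) t)); last first.
  by apply/funext => t; rewrite big_cons.
split; first exact: smeasD.
by apply: approxD => //; apply: approx_indicator => //; exact: measurableI.
Qed.

Lemma L2w_integrable rho f : L2w rho f ->
  mu.-integrable setT (fun t => (N (f t) ^+ 2 * weight rho t)%:E).
Proof.
move=> [sf wf]; apply/integrableP; split; first exact: measurable_wnormsqE.
by under eq_integral do rewrite gee0_abs ?wnormsq_ge0//.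
Qed.

(* Truncating the simple approximants [g k] where they exceed twice the norm of [f]
   keeps them simple and makes [3 * N f] a dominating function. *)
Lemma L2w_approx rho J (al be : nat -> R) f :
  (forall k t, al k < t < be k -> J t) ->
  (forall t, J t -> \forall k \near \oo, al k < t < be k) ->
  L2w rho f -> (forall t, ~ J t -> f t = 0) -> approx rho J f.
Proof.
move=> abJ Jab L2f fJ; have [sf wf] := L2f; have [g [sg gf]] := sf.
(* Squared norms are values of [rip], whose measurability is known. *)
pose E k : set R := [set t | N (g k t) ^+ 2 <= 4 * N (f t) ^+ 2].
have mE k : measurable (E k).
  rewrite -[E k]setTI; apply: measurable_fun_le => //.
    by under eq_fun do rewrite normH_sq; exact: simple_rip.
  apply: measurable_funM => //.
  by under eq_fun do rewrite normH_sq; exact: smeas_rip.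
pose u k := chop (E k `&` window (al k) (be k)) (g k).
have su k : smeas (u k).
  apply: smeas_chop; last exact: smeas_simple.
  by apply: measurableI => //; exact: measurable_window.
apply: (approx_lim _ _ u) => //.
  by move=> k; apply: approx_simple => //; exact: abJ.
have EP k t : E k t -> N (g k t) <= 2 * N (f t).
  rewrite /E /= => h; rewrite -ler_sqr ?nnegrE ?mulr_ge0 ?normH_ge0// exprMn.
  by apply: le_trans h _; lra.
have nEP k t : ~ E k t -> 2 * N (f t) <= N (g k t).
  move=> /negP; rewrite -ltNge => /ltW h.
  rewrite -ler_sqr ?nnegrE ?mulr_ge0 ?normH_ge0// exprMn.
  by apply: le_trans h; lra.
apply: (wint_dominated _ _ _ (fun t => 9 * N (f t) ^+ 2)) => //.
- move=> t; have [Jt|nJt] := pselect (J t); last first.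
    apply: cvg_near_cst; near=> k; rewrite /u /chop fJ// asboolF ?subrr ?normH0//.
    by move=> [_ /abJ].
  apply: (@squeeze_cvgr _ _ _ _ (fun=> 0) (fun k => N (g k t - f t))).
  + near=> k; rewrite normH_ge0 /= /u /chop; case: asboolP => // h.
    rewrite sub0r normHN.
    (* For large [k] the window contains [t], so a truncation there means
       [2 * N (f t) <= N (g k t)], whence [N (f t) <= N (g k t - f t)]. *)
    have /nEP nE : ~ E k t by move=> Et; apply: h; split=> //; near: k; exact: Jab.
    have := normHD (g k t - f t) (f t); rewrite subrK; lra.
  + exact: cvg_cst.
  + exact: gf.
- move=> k t; rewrite (_ : 9 = 3 ^+ 2); last by ring.
  rewrite -exprMn ler_sqr ?nnegrE ?mulr_ge0 ?normH_ge0//.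
  rewrite /u /chop; case: asboolP => [[/EP h _]|_].
    by have := normHB (g k t) (f t); lra.
  by rewrite sub0r normHN; have := normH_ge0 (f t); lra.
- have := integrableZl measurableT 9 (L2w_integrable _ _ L2f).
  by under eq_fun do rewrite -EFinM mulrA.
Unshelve. all: by end_near. Qed.

(** Replacing [f] by its restriction to the open ray after [a] changes it only on a null set, and
    the windows []a, k[] exhaust that ray. *)
Lemma vanish_approx rho a f : L2w rho f -> vanish_before a f ->
  approx rho [set t | a < t] f.
Proof.
move=> L2f fa; have [sf wf] := L2f.
pose fa' := chop [set t | a < t] f.
have mJ : measurable [set t | a < t].
  rewrite (_ : [set t | _] = `]a, +oo[%classic); first exact: measurable_itv.
  by rewrite predeqE => t; rewrite /= in_itv /= andbT.
have sfa : smeas fa' by exact: smeas_chop.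
have aefa : {ae mu, forall t, f t = fa' t}.
  (* The hypothesis says nothing at [a] itself, which is discarded as a null singleton. *)
  have na : {ae mu, forall t, t != a}.
    exists [set a]; split=> //; first exact: lebesgue_measure_set1.
    by move=> t /= /negP; rewrite negbK => /eqP.
  apply: (@filterS2 _ _ (ae_filter_ringOfSetsType mu) _ _ _ _ fa na) => t h ta.
  rewrite /fa' /chop; case: asboolP => //= /negP; rewrite -leNgt le_eqVlt (negbTE ta) /=.
  exact: h.
have L2fa : L2w rho fa' by split=> //; rewrite -(wint_ae _ _ _ sf sfa aefa).
have afa : approx rho [set t | a < t] fa'.
  apply: (L2w_approx _ _ (fun=> a) (fun k => k%:R)) => //.
  - by move=> k t /andP[].
  - move=> t /= at0; near=> k; rewrite at0 /=; near: k; exact: nbhs_infty_gtr.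
  - by move=> t nt; rewrite /fa' /chop asboolF.
move=> e e0; have [phi [tphi pe]] := afa e e0; exists phi; split=> //.
rewrite (_ : wint _ _ = wint rho (fun t => fa' t - phi t))//.
have sphi := testf_smeas _ _ tphi.
apply: wint_ae; try exact: smeasB.
by apply: ae_imply aefa => t ->.
Unshelve. all: by end_near. Qed.

Lemma full_approx rho f : L2w rho f -> approx rho setT f.
Proof.
move=> L2f; apply: (L2w_approx _ _ (fun k => - k%:R) (fun k => k%:R)) => //.
- by move=> t _; near=> k; rewrite -ltr_norml; near: k; exact: nbhs_infty_gtr.
- by move=> t /(_ I).
Unshelve. all: by end_near. Qed.

Lemma L2w_chop rho f (A : set R) : measurable A -> L2w rho f -> L2w rho (chop A f).
Proof.
move=> mA [sf wf]; have sA := smeas_chop _ _ mA sf; split=> //.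
apply: le_lt_trans wf; apply: ge0_le_integral => //.
- by move=> t _; exact: (wnormsq_ge0 _ (chop A f)).
- exact: (measurable_wnormsqE _ (chop A f)).
- exact: measurable_wnormsqE.
- move=> t _; rewrite lee_fin ler_wpM2r ?expR_ge0// /chop; case: asboolP => // _.
  by rewrite normH0 expr0n sqr_ge0.
Qed.

Lemma rip_integrable rho f g : L2w rho f -> L2w rho g ->
  mu.-integrable setT (fun t => (rip (f t) (g t) * weight rho t)%:E).
Proof.
move=> L2f L2g; have [sf _] := L2f; have [sg _] := L2g.
have h := integrableD measurableT (L2w_integrable _ _ L2f) (L2w_integrable _ _ L2g).
apply: le_integrable h => //.
  apply/measurable_EFinP; apply: measurable_funM; last exact: measurable_weight.
  exact: smeas_rip.
move=> t _; rewrite -EFinD !abse_EFin lee_fin normrM (gtr0_norm (weight_gt0 _ _)) -mulrDl.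
rewrite normrM (gtr0_norm (weight_gt0 _ _)) ler_wpM2r ?expR_ge0//.
by apply: le_trans (rip_le_sq _ _) _; exact: ler_norm.
Qed.

(* Orthogonality to the test functions forces [f = 0] since
   [N f ^+ 2 <= N (f - phi) ^+ 2 + 2 * rip f phi], where the weight can be
   absorbed into [phi]. *)
Lemma orthogonal_vanish rho b f : L2w rho f ->
  (forall phi, testf [set t | t < b] phi ->
    (\int[mu]_(t in setT) rip (f t) (phi t))%R = 0) ->
  vanish_before b f.
Proof.
move=> L2f ortho.
have mJ : measurable [set t | t < b].
  rewrite (_ : [set t | _] = `]-oo, b[%classic); first exact: measurable_itv.
  by rewrite predeqE => t; rewrite /= in_itv.
pose fb := chop [set t | t < b] f.
have L2fb : L2w rho fb by exact: L2w_chop.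
have afb : approx rho [set t | t < b] fb.
  apply: (L2w_approx _ _ (fun k => - k%:R) (fun=> b)) => //.
  - by move=> k t /andP[].
  - move=> t /= tb; near=> k; rewrite tb andbT ltrNl; near: k; exact: nbhs_infty_gtr.
  - by move=> t nt; rewrite /fb /chop asboolF.
have wb : wint rho fb = 0%E.
  apply/eqP; rewrite eq_le wint_ge0 andbT; apply/lee_addgt0Pr => e e0; rewrite add0e.
  have [phi [tphi pe]] := afb e e0; have L2phi := testf_L2w _ _ rho tphi.
  have L2d := L2wB _ _ _ L2fb L2phi.
  apply: ltW; apply: le_lt_trans pe.
  have i1 := L2w_integrable _ _ L2d; have i2 := rip_integrable _ _ _ L2fb L2phi.
  have i3 := integrableZl measurableT 2 i2.
  have o : (\int[mu]_(t in setT) (rip (fb t) (phi t) * weight rho t)%:E = 0)%E.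
    rewrite -[LHS]fineK; last exact: integrable_fin_num.
    have tw := testfZ _ _ _ (smooth_weight rho) tphi.
    rewrite -[RHS]/(0%R%:E) -(ortho _ tw) /Rintegral; congr ((fine _)%:E).
    apply: eq_integral => t _.
    (* Where [fb] may differ from [f], the test function [phi] vanishes. *)
    rewrite ripZr mulrC; congr (_ * _)%:E; rewrite /fb /chop; case: asboolP => // nt.
    by rewrite (testf_out _ _ _ tphi nt) !rip0r.
  have : (wint rho fb <= \int[mu]_(t in setT)
     ((N (fb t - phi t) ^+ 2 * weight rho t)%:E + 2%:E * (rip (fb t) (phi t) * weight rho t)%:E))%E.
    apply: le_integral => //.
    + exact: L2w_integrable.
    + exact: integrableD.
    move=> t _; rewrite -EFinM -EFinD lee_fin -/(weight rho t) mulrA -mulrDl.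
    rewrite ler_wpM2r ?expR_ge0// !normH_sq !(ripDl, ripDr, ripNl, ripNr) (ripC (phi t)).
    by have := rip_ge0 (phi t); lra.
  by rewrite integralD// integralZl// o mule0 adde0.
have mfb : @measurable_fun _ _ (measurableTypeR R) _ setT
    (fun t => (N (fb t) ^+ 2 * weight rho t)%:E).
  by apply: measurable_wnormsqE; case: L2fb.
have [+ _] := ae_eq_integral_abs mu measurableT mfb.
under eq_integral do rewrite gee0_abs ?wnormsq_ge0//.
move=> /(_ wb); apply: ae_imply => t /(_ I) [] /eqP.
rewrite mulf_eq0 (gt_eqF (weight_gt0 _ _)) orbF expf_eq0 /= => /eqP/normH_eq0 h tb.
by move: h; rewrite /fb /chop asboolT.
Unshelve. all: by end_near. Qed.

(** * Causality *)

Notation wnorm := (wnorm inner).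

Lemma wnorm_ge0 rho f : 0 <= wnorm rho f.
Proof. exact: sqrtr_ge0. Qed.

Lemma wnorm_le rho f (e : R) : 0 <= e -> (wint rho f <= (e ^+ 2)%:E)%E -> wnorm rho f <= e.
Proof.
move=> e0 h; have fw : wint rho f \is a fin_num.
  by rewrite ge0_fin_numE ?wint_ge0//; exact: le_lt_trans h (ltry _).
rewrite -[leRHS](ger0_norm e0) -sqrtr_sqr /Defs.wnorm; apply: ler_wsqrtr.
by rewrite -lee_fin fineK.
Qed.

(** Compares with the norm of weight 0, which does not move with [rho]; the weight only has to be
    bounded where [f] is nonzero. *)
Lemma wnorm_reweight rho f (C : R) : 0 <= C -> L2w 0 f ->
  (forall t, f t = 0 \/ weight rho t <= C ^+ 2) -> wnorm rho f <= C * wnorm 0 f.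
Proof.
move=> C0 [sf wf] fC; apply: wnorm_le; first by rewrite mulr_ge0// wnorm_ge0.
have fw : wint 0 f \is a fin_num by rewrite ge0_fin_numE ?wint_ge0.
rewrite exprMn sqr_sqrtr ?fine_ge0 ?wint_ge0// EFinM fineK//.
rewrite /Defs.wint -ge0_integralZl ?lee_fin ?sqr_ge0//; first last.
- by move=> t _; exact: wnormsq_ge0.
- exact: measurable_wnormsqE.
apply: ge0_le_integral => //.
- by move=> t _; exact: wnormsq_ge0.
- exact: measurable_wnormsqE.
- by apply: measurable_funeM; exact: measurable_wnormsqE.
move=> t _; rewrite -EFinM lee_fin mulr0 mul0r oppr0 expR0 mulr1 mulrC.
by case: (fC t) => [->|h]; [rewrite normH0 expr0n !mulr0 | rewrite ler_wpM2r ?sqr_ge0].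
Qed.

(** [is_dinv] tests against derivatives of functions in [Cplus]; this makes every test function
    available as such a derivative. *)
Lemma testf_primitive J f : testf J f -> exists psi, Cplus inner psi /\ is_derivH inner psi f.
Proof.
move=> tf; have [D [D0 [sD csD]]] := testf_Cc _ _ tf.
suff [psi [dpsi [b psib]]] : exists psi, is_derivH inner psi f /\
    exists b : R, forall t, b < t -> psi t = 0.
  (* The derivatives of [f] are shifted by one behind [psi], so the derivative of order 1 is the
     compactly supported one. *)
  exists psi; split=> //; exists (fun n => if n is m.+1 then D m else psi); split=> //.
  split; first by move=> [|n] t; [rewrite D0; exact: dpsi | exact: sD].
  by split; [exists b | exists 1%N; rewrite D0].
elim: tf {D D0 sD csD} => {f} [|h c f [sh [al [be hab]] _] _ [psi [dpsi [b psib]]]].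
  by exists (fun=> 0); split; [move=> t; exact: hasderivH_cst | exists 0].
have [G [dG G0]] := smooth_primitive _ _ _ sh hab.
exists (fun t => ofR S (G t) *: c + psi t); split.
  by move=> t; apply: hasderivHD; [exact: hasderivHZ | exact: dpsi].
exists (Num.max b be) => t; rewrite gt_max => /andP[bt bet].
by rewrite psib// G0 ?ltW// (ofR0 hS) scale0r addr0.
Qed.

(** Multiplying [phi] by the weight of [- rho] gives another test function and cancels the weight of
    [rho]. *)
Lemma rip_testf_integrable rho J f phi : L2w rho f -> testf J phi ->
  mu.-integrable setT (fun t => (rip (f t) (phi t))%:E).
Proof.
move=> L2f tphi; have tw := testfZ _ _ _ (smooth_weight (- rho)) tphi.
have := rip_integrable _ _ _ L2f (testf_L2w _ _ rho tw).
congr (mu.-integrable _ _); apply/funext => t; congr (_%:E).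
rewrite ripZr mulrAC -expRD (_ : _ + _ = 0) ?expR0 ?mul1r//.
by ring.
Qed.

Lemma causal_on_testf (rho0 s a b : R) (F : (R -> H) -> (R -> H) -> K S) :
  0 <= s -> b < a ->
  (forall rho, rho0 < rho -> forall u w psi psi', Cc inner u -> Cc inner w ->
     Cplus inner psi -> is_derivH inner psi psi' ->
     absK S (F u psi - F w psi) <= s * wnorm (- rho) psi' * wnorm rho (fun t => u t - w t)) ->
  forall u w psi phi, testf setT u -> testf setT w ->
    testf [set t | a < t] (fun t => u t - w t) ->
    Cplus inner psi -> is_derivH inner psi phi -> testf [set t | t < b] phi ->
    F u psi = F w psi.
Proof.
move=> s0 ba hF u w psi phi tu tw td cpsi dpsi tphi.
apply/eqP; rewrite -subr_eq0; apply/eqP; apply: (absK_le0 hS).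
apply/ler_addgt0Pr => e e0; rewrite add0r.
set A := wnorm 0 phi; set B := wnorm 0 (fun t => u t - w t).
set C := s * A * B.
have C0 : 0 <= C by rewrite !mulr_ge0 ?wnorm_ge0.
have ab0 : 0 < a - b by rewrite subr_gt0.
(* The first terms put [rho] above [rho0] and 0. The last gives [C / e <= rho * (a - b)], so
   [C * expR (- (rho * (a - b))) <= e] because [1 + y <= expR y]. *)
pose rho := Num.max rho0 0 + 1 + C / (e * (a - b)).
have q0 : 0 <= C / (e * (a - b)) by rewrite divr_ge0// mulr_ge0 ?ltW.
have rho_gt0 : 0 < rho.
  by rewrite /rho ltr_wpDr// ltr_wpDl ?ltr01// le_max lexx orbT.
have rho_gt : rho0 < rho.
  rewrite /rho ltr_wpDr// (le_lt_trans (y := Num.max rho0 0))//; last by rewrite ltrDl.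
  by rewrite le_max lexx.
apply: le_trans (hF _ rho_gt _ _ _ _ (testf_Cc _ _ tu) (testf_Cc _ _ tw) cpsi dpsi) _.
(* The weight of [- rho] increases in [t] and [phi] lives before [b]; symmetrically in [h2], the
   weight of [rho] decreases and [u - w] lives after [a]. *)
have h1 : wnorm (- rho) phi <= expR (rho * b) * A.
  apply: wnorm_reweight; [exact: expR_ge0|exact: testf_L2w tphi|move=> t].
  have [tb|tb] := ltP t b; last by left; apply: (testf_out _ _ _ tphi); apply/negP; rewrite -leNgt.
  right; rewrite expr2 -expRD ler_expR.
  have := ler_wpM2l (ltW rho_gt0) (ltW tb); lra.
have h2 : wnorm rho (fun t => u t - w t) <= expR (- (rho * a)) * B.
  apply: wnorm_reweight; [exact: expR_ge0|exact: testf_L2w td|move=> t].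
  have [ta|ta] := ltP a t; last first.
    by left; apply: (testf_out _ _ _ td); apply/negP; rewrite -leNgt.
  right; rewrite expr2 -expRD ler_expR.
  have := ler_wpM2l (ltW rho_gt0) (ltW ta); lra.
apply: (@le_trans _ _ (s * (expR (rho * b) * A) * (expR (- (rho * a)) * B))).
  by rewrite ler_pM ?mulr_ge0 ?wnorm_ge0// ler_wpM2l.
have -> : s * (expR (rho * b) * A) * (expR (- (rho * a)) * B) =
    C * expR (- (rho * (a - b))).
  rewrite (_ : - (rho * (a - b)) = rho * b + - (rho * a)); last by ring.
  by rewrite expRD /C; ring.
rewrite expRN ler_pdivrMr ?expR_gt0//.
have h3 : C / e <= rho * (a - b).
  have -> : C / e = C / (e * (a - b)) * (a - b).
    by field; rewrite !gt_eqF.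
  rewrite ler_wpM2r ?(ltW ab0)// /rho lerDr addr_ge0// le_max lexx orbT//.
have h4 := expR_ge1Dx (rho * (a - b)).
rewrite -ler_pdivrMl// mulrC; apply: le_trans h3 _; apply: le_trans h4.
by rewrite lerDr.
Qed.

(** Approximating [x] and [y] independently would lose their agreement before [a]. Instead [x] is
    approximated by [u] and [x - y] by some [d] living after [a]; then [w = u - d] approximates [y],
    and [u - w] is exactly [d]. *)
Lemma extension_causal (rho a : R) (F Frho : (R -> H) -> (R -> H) -> K S)
    (x y psi phi : R -> H) :
  (forall u w, testf setT u -> testf setT w ->
     testf [set t | a < t] (fun t => u t - w t) -> F u psi = F w psi) ->
  lip_extension inner rho F Frho -> L2w rho x -> L2w rho y ->
  vanish_before a (fun t => x t - y t) -> Cplus inner psi -> is_derivH inner psi phi ->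
  Frho x psi = Frho y psi.
Proof.
move=> hF [_ ext [L lip]] L2x L2y xy cpsi dpsi.
apply/eqP; rewrite -subr_eq0; apply/eqP; apply: (absK_le0 hS).
apply/ler_addgt0Pr => e e0; rewrite add0r.
pose P := `|L| * wnorm (- rho) phi.
have P0 : 0 <= P by rewrite mulr_ge0// wnorm_ge0.
(* Two Lipschitz errors of size [P * eta] must add up to at most [e]; the summand 1 avoids dividing
   by 0. *)
pose eta := e / (2 * P + 1).
have P1 : 0 < 2 * P + 1 by lra.
have eta0 : 0 < eta by rewrite divr_gt0.
have e4 : 0 < eta ^+ 2 / 4 by rewrite divr_gt0// exprn_gt0.
have [u [tu ue]] := full_approx _ _ L2x _ e4.
have [d [td de]] := vanish_approx _ _ _ (L2wB _ _ _ L2x L2y) xy _ e4.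
have td' : testf setT d by apply: testfW td.
pose w t := u t - d t.
have tw : testf setT w by exact: testfB.
have uw : F u psi = F w psi.
  apply: hF => //; rewrite (_ : (fun t => _) = d)//.
  by apply/funext => t; rewrite /w opprB addrC subrK.
have L2u := testf_L2w _ _ rho tu; have L2d := testf_L2w _ _ rho td.
have L2w' := testf_L2w _ _ rho tw.
have sxu : smeas (fun t => x t - u t) by case: (L2wB _ _ _ L2x L2u).
have sxyd : smeas (fun t => - (x t - y t - d t)).
  by case: (L2wN _ _ (L2wB _ _ _ (L2wB _ _ _ L2x L2y) L2d)).
have hx : wnorm rho (fun t => x t - u t) <= eta.
  apply: wnorm_le (ltW eta0) _; apply: le_trans (ltW ue) _; rewrite lee_fin.
  by have := sqr_ge0 eta; lra.
have hy : wnorm rho (fun t => w t - y t) <= eta.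
  apply: wnorm_le (ltW eta0) _; rewrite -wintN.
  rewrite (_ : (fun t => _) = (fun t => (x t - u t) + - (x t - y t - d t))).
    by apply: ltW; apply: wintD_lt => //; rewrite wintN.
  apply/funext => t; rewrite /w !opprB [RHS]addrC [RHS]addrA -(addrA (d t)) subrK.
  by rewrite addrA [y t + _]addrC.
have lipP p q : L2w rho p -> L2w rho q -> wnorm rho (fun t => p t - q t) <= eta ->
    absK S (Frho p psi - Frho q psi) <= P * eta.
  move=> L2p L2q pq; apply: le_trans (lip _ _ _ _ L2p L2q cpsi dpsi) _.
  apply: (@le_trans _ _ (P * wnorm rho (fun t => p t - q t))); last exact: ler_wpM2l.
  by rewrite !ler_wpM2r ?wnorm_ge0 ?ler_norm.
(* On test functions [Frho] is [F], so [uw] cancels the two middle terms. *)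
have -> : Frho x psi - Frho y psi = (Frho x psi - Frho u psi) + (Frho w psi - Frho y psi).
  rewrite (ext u psi (testf_Cc _ _ tu) cpsi) (ext w psi (testf_Cc _ _ tw) cpsi).
  by rewrite uw addrA subrK.
apply: le_trans (absKD hS _ _) _.
apply: le_trans (lerD (lipP _ _ L2x L2u hx) (lipP _ _ L2w' L2y hy)) _.
rewrite -mulrDl /eta mulrA ler_pdivrMr// mulrC.
by have := ltW e0; nra.
Qed.

Lemma lipschitz_causal (rho0 s : R) (F : (R -> H) -> (R -> H) -> K S) :
  0 <= s ->
  (forall rho, rho0 < rho -> forall u w psi psi', Cc inner u -> Cc inner w ->
     Cplus inner psi -> is_derivH inner psi psi' ->
     absK S (F u psi - F w psi) <= s * wnorm (- rho) psi' * wnorm rho (fun t => u t - w t)) ->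
  forall rho Frho, lip_extension inner rho F Frho -> causal_dinv inner rho Frho.
Proof.
move=> s0 hF rho Frho ext a x y v w L2x L2y xy [L2v vE] [L2w' wE].
have vb b : b < a -> vanish_before b (fun t => v t - w t).
  move=> ba; apply: (orthogonal_vanish rho); first exact: L2wB.
  (* A primitive of [- phi] is taken since [is_dinv] pairs with minus the derivative. *)
  move=> phi tphi; have [psi [cpsi dpsi]] := testf_primitive _ _ (testfN _ _ tphi).
  have Fxy : Frho x psi = Frho y psi.
    apply: (extension_causal rho a F Frho x y psi (fun t => - phi t)) => // u u' tu tu' td.
    exact: (causal_on_testf rho0 s a b F s0 ba hF _ _ psi _ tu tu' td cpsi dpsi (testfN _ _ tphi)).
  move: (congr1 (reK S) Fxy).
  rewrite (vE _ _ cpsi dpsi) (wE _ _ cpsi dpsi) !(reK_Kint hS).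
  have E (z : R -> H) : (\int[mu]_(t in setT) reK S (inner (z t) (- - phi t)))%R =
      (\int[mu]_(t in setT) rip (z t) (phi t))%R.
    by apply: eq_Rintegral => t _; rewrite opprK.
  rewrite !E => Evw.
  have iv := rip_testf_integrable _ _ _ _ L2v tphi.
  have iw := rip_testf_integrable _ _ _ _ L2w' tphi.
  have := RintegralB measurableT iv iw; rewrite Evw subrr => <-.
  by apply: eq_Rintegral => t _; rewrite ripDl ripNl.
(* Exceptional null sets depend on [b], so [b] runs through a sequence increasing to [a] and
   countably many are united. *)
have : {ae mu, forall t, forall k, t < a - k.+1%:R^-1 -> v t - w t = 0}.
  by apply: ae_foralln => k; apply: vb; rewrite ltrBlDr ltrDl.
apply: ae_imply => t h ta.
have [k hk] : exists k : nat, k.+1%:R^-1 < a - t.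
  by have /ltr_add_invr[k hk] := ta; exists k; rewrite ltrBrDl.
by apply: (h k); rewrite ltrBrDl -ltrBrDr.
Qed.

End RealInner.

Theorem theorem4p5 (R : realType) (S : Scalars R)
  (hS : S = RealS R \/ S = CplxS R)
  (H : lmodType (K S)) (inner : H -> H -> K S) (hH : is_hilbert inner)
  (rho0 : R) (hrho0 : 0 < rho0) (s : R) (hs0 : 0 < s) (hs1 : s < 1)
  (F : (R -> H) -> (R -> H) -> K S)
  (hFlin : forall u, Cc inner u -> linear_on_Cplus inner (F u))
  (hF : forall rho, rho0 < rho -> exists Kc : R, 0 < Kc /\
     (forall psi psi', Cplus inner psi -> is_derivH inner psi psi' ->
        absK S (F (fun _ => 0) psi) <= Kc * wnorm inner (- rho) psi') /\
     (forall u w psi psi', Cc inner u -> Cc inner w ->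
        Cplus inner psi -> is_derivH inner psi psi' ->
        absK S (F u psi - F w psi)
          <= s * wnorm inner (- rho) psi' * wnorm inner rho (fun t => u t - w t))) :
  forall rho, rho0 < rho ->
  forall Frho : (R -> H) -> (R -> H) -> K S,
    lip_extension inner rho F Frho ->
    causal_dinv inner rho Frho.
Proof.
move=> rho _ Frho.
apply: (lipschitz_causal hS hH rho0 s F (ltW hs0)) => rho' /hF[Kc [_ [_ lip]]].
exact: lip.
Qed.
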